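(* Let $p$ be a prime with $p\equiv 3\pmod 4$, $p\ne 3$, and let $v$ be a primitive root modulo $p$. Let $\delta$ be an integer with $1\le\delta\le p-2$, and let $$I_\delta=\{\,i\mid 0\le i\le p-2,\ v_{(p-1)/2-i}+v_{(p-1)/2-i+\mathrm{ind}_v(\delta)}>p\,\}.$$ If $h$ is an odd prime dividing the class number $h(\mathbb{Q}(\sqrt{-p}))$, then $$\sum_{i\in I_\delta}(-1)^i\ne 0\qquad\text{and}\qquad\sum_{i\in I_\delta}(-1)^i\equiv 0\pmod h.$$
   Context: For $n\in\mathbb{Z}$, $v_n$ denotes the integer with $v_n\equiv v^n\pmod p$ and $1\le v_n\le p-1$. The index $\mathrm{ind}_v(\delta)$ is the minimal integer $s\ge 0$ such that $\delta=v_s$. *)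

(* Defs.v *)
From HB Require Import structures.
From mathcomp Require Import all_boot all_order all_algebra all_field.
From mathcomp Require Import finmap boolp classical_sets functions cardinality.

Set Implicit Arguments.
Unset Strict Implicit.
Unset Printing Implicit Defensive.

Import Order.TTheory GRing.Theory Num.Theory.
Local Open Scope ring_scope.

Section ClassNumber.
Variable K : fieldExtType rat.

Definition ring_of_integers : set K :=
  [set x | integralOver (intr : int -> K) x]%classic.

Definition integral_ideal (I : set K) : Prop :=
  [/\ (I `<=` ring_of_integers)%classic,
      I 0,
      forall x y, I x -> I y -> I (x + y) &
      forall a x, ring_of_integers a -> I x -> I (a * x)].

Definition nonzero_ideal (I : set K) : Prop :=
  integral_ideal I /\ exists2 x, I x & x != 0.

Definition ideal_equiv (I J : set K) : Prop :=
  exists a b, [/\ ring_of_integers a, ring_of_integers b, a != 0, b != 0 &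
    ([set a * x | x in I] = [set b * y | y in J])%classic].

Definition ideal_class (I : set K) : set (set K) :=
  [set J | nonzero_ideal J /\ ideal_equiv I J]%classic.

Definition ideal_classes : set (set (set K)) :=
  [set ideal_class I | I in nonzero_ideal]%classic.

(* [fset_set] sends an infinite set to the empty one, so the value would be 0
   if there were infinitely many classes. *)
Definition class_number : nat := #|` fset_set ideal_classes|%fset.

End ClassNumber.

(* K is a copy of Q(sqrt d); quantifying over all such K avoids fixing a model. *)
Definition is_Q_sqrt (K : fieldExtType rat) (d : int) : Prop :=
  exists2 s : K, s ^+ 2 = d%:~R & <<1; s>>%VS = fullv.

Definition primitive_root_mod (p : nat) (v : int) : bool :=
  p.-1.-primitive_root (v%:~R : 'F_p).

(* For p prime not dividing v, this is the integer congruent to v ^ n mod p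
   and lying between 1 and p - 1; the power is taken in 'F_p, so that n may
   be negative. *)
Definition pow_mod (p : nat) (v : int) (n : int) : nat :=
  val ((v%:~R : 'F_p) ^ n).

Definition ind (p : nat) (v : int) (delta : nat) : nat :=
  if pselect (exists s : nat, delta == pow_mod p v s%:Z) is left ex
  then ex_minn ex else 0%N.

Definition I_set (p : nat) (v : int) (delta : nat) : {set 'I_p.-1} :=
  [set i : 'I_p.-1 |
    (p < pow_mod p v ((p.-1)./2%:Z - i%:Z)
         + pow_mod p v ((p.-1)./2%:Z - i%:Z + (ind p v delta)%:Z))%N]%SET.

(* Main.v *)
(** The character sum equals -(1 + chi(d) - chi(1 + d)) B, where chi is the Legendre symbol
    and p B = sum_x chi(x) x, because p [x + dx mod p > p] = x + (dx mod p) - ((1 + d) x mod p).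
    Both factors are odd, so the sum is nonzero; it remains to see that h divides B.

    By Cauchy's theorem it is enough that the B-th power of every ideal class of
    Q(sqrt(-p)) is trivial, and only for the classes of the prime ideals of prime norm l.
    This is Stickelberger's theorem.  For l <> p let f be the order of l modulo p.  A product P
    of Gauss sums of order p over the field with l^f elements, taken over representatives of the
    squares modulo the subgroup generated by l, lies in Q(sqrt(-p)) and has norm
    l^((p-1)/2).  If omega is the Teichmueller character, then g(omega^-m) divides
    g(omega^-1)^s, where s is the sum of the base l digits of m, since products of
    Gauss sums are Jacobi sums times Gauss sums; and g(omega^-1)^(l-1) is exactly divisible by l.
    This bounds the valuations of P and of its conjugate from above, and as the two
    bounds add up to the valuation of the norm they are equalities.  Dividing P by its
    content leaves an element of norm l^|B| generating the |B|-th power of a prime above l. *)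

Require Import Defs.
From HB Require Import structures.
From mathcomp Require Import all_boot all_order all_fingroup all_solvable all_algebra all_field all_character.
From mathcomp Require Import ring zify.
From mathcomp Require Import finmap boolp classical_sets functions cardinality.

Set Implicit Arguments.
Unset Strict Implicit.
Unset Printing Implicit Defensive.

Import Order.TTheory GRing.Theory Num.Theory.
Local Open Scope ring_scope.

(** * Reduction of cyclotomic integers to a finite field *)

(** No prime ideal or valuation of the cyclotomic field is constructed. One reduction map from
    Z[eps] to the finite field stands for a place above l: a number that has a reduction is integral
    there, one with nonzero reduction is a unit there, and a bound on a valuation is an equation J *
    z = l^b * w with w of nonzero reduction. Such equations bound valuations from above only, which
    is why the product and its conjugate are played against each other through their norm. One place
    serves both, because the conjugate is the same kind of product over nonresidues. Invertibility
    of ideals is avoided as well: once all n-th powers of classes are trivial, the commutative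
    monoid of classes has the inverses x^(n-1), which makes Cauchy's theorem available. Finiteness
    of the set of classes must be established, since otherwise [class_number] would be 0 and
    divisible by every h. The oddness of B serves twice: for the nonvanishing of the sum, and for
    the positivity of the exponent |B|. *)

Section Reduction.

Variables (E : fieldType) (eps : algC) (x0 : E).

(* A place of Z[eps], presented as the graph of F(eps) |-> F(x0); it is single-valued when x0 is
   a root of the cyclotomic polynomial of eps (reduces_fun). *)
Definition reduces (z : algC) (y : E) :=
  exists F : {poly int}, z = (map_poly intr F).[eps] /\ y = (map_poly intr F).[x0].

Lemma reduces_int (m : int) : reduces m%:~R m%:~R.
Proof. by exists m%:P; rewrite !map_polyC !hornerC. Qed.

Lemma reduces_nat (m : nat) : reduces m%:R m%:R.
Proof. by have := reduces_int m; rewrite !pmulrn. Qed.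

Lemma reduces0 : reduces 0 0.
Proof. exact: (reduces_int 0). Qed.

Lemma reduces1 : reduces 1 1.
Proof. exact: (reduces_int 1). Qed.

Lemma reduces_eps : reduces eps x0.
Proof. by exists 'X; rewrite !map_polyX !hornerX. Qed.

Lemma reducesD z y z' y' :
  reduces z y -> reduces z' y' -> reduces (z + z') (y + y').
Proof. by move=> [F [-> ->]] [G [-> ->]]; exists (F + G); rewrite !rmorphD !hornerD. Qed.

Lemma reducesN z y : reduces z y -> reduces (- z) (- y).
Proof. by move=> [F [-> ->]]; exists (- F); rewrite !rmorphN !hornerN. Qed.

Lemma reducesB z y z' y' :
  reduces z y -> reduces z' y' -> reduces (z - z') (y - y').
Proof. by move=> h h'; apply: reducesD => //; apply: reducesN. Qed.

Lemma reducesM z y z' y' :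
  reduces z y -> reduces z' y' -> reduces (z * z') (y * y').
Proof. by move=> [F [-> ->]] [G [-> ->]]; exists (F * G); rewrite !rmorphM !hornerM. Qed.

Lemma reducesX n z y : reduces z y -> reduces (z ^+ n) (y ^+ n).
Proof.
move=> h; elim: n => [|n IHn]; first exact: reduces1.
by rewrite !exprS; apply: reducesM.
Qed.

Lemma reduces_sum I (r : seq I) (P : pred I) (f : I -> algC) (g : I -> E) :
  (forall i, P i -> reduces (f i) (g i)) ->
  reduces (\sum_(i <- r | P i) f i) (\sum_(i <- r | P i) g i).
Proof.
move=> h; apply: (big_ind2 reduces) => //; first exact: reduces0.
by move=> *; apply: reducesD.
Qed.

Lemma reduces_prod I (r : seq I) (P : pred I) (f : I -> algC) (g : I -> E) :
  (forall i, P i -> reduces (f i) (g i)) ->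
  reduces (\prod_(i <- r | P i) f i) (\prod_(i <- r | P i) g i).
Proof.
move=> h; apply: (big_ind2 reduces) => //; first exact: reduces1.
by move=> *; apply: reducesM.
Qed.

Lemma reduces_ex_sum I (r : seq I) (P : pred I) (f : I -> algC) :
  (forall i, P i -> exists y, reduces (f i) y) ->
  exists y, reduces (\sum_(i <- r | P i) f i) y.
Proof.
move=> h; apply: (big_ind (fun z => exists y, reduces z y)) => //.
  by exists 0; apply: reduces0.
by move=> x x' [y ry] [y' ry']; exists (y + y'); apply: reducesD.
Qed.

Variable N : nat.
Hypothesis epsP : N.-primitive_root eps.
Hypothesis x0P : root (map_poly intr 'Phi_N) x0.

(** By additivity only z = 0 matters. Division of F by the monic Phi_N leaves a remainder that
    vanishes at eps and has smaller degree than the minimal polynomial of eps over Q, so it is zero;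
    then Phi_N divides F over the integers and F vanishes at x0. *)
Lemma reduces_fun z y y' : reduces z y -> reduces z y' -> y = y'.
Proof.
move=> hz hz'; apply/eqP; rewrite -subr_eq0; apply/eqP.
have := reducesB hz hz'; rewrite subrr.
move: (y - y') => d {hz hz'} [F [F0 ->]].
have mon := Cyclotomic_monic N.
have DF := Pdiv.RingMonic.rdivp_eq mon F.
set R := Pdiv.Ring.rmodp F _ in DF.
have R0 : (map_poly intr R : {poly algC}).[eps] = 0.
  move: F0; rewrite DF rmorphD rmorphM hornerD hornerM.
  have -> : (map_poly intr 'Phi_N : {poly algC}).[eps] = 0.
    by apply/eqP; rewrite (Cintr_Cyclotomic epsP) -/(root _ _) root_cyclotomic.
  by rewrite mulr0 add0r => <-.
have R00 : R = 0.
  have inj : injective (intr : int -> rat) by move=> m n /intr_inj.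
  apply: (map_inj_poly inj) => //; rewrite rmorph0; apply/eqP.
  have [q [Dq mq] dvq] := minCpolyP eps.
  have : q %| (map_poly intr R : {poly rat}).
    rewrite -dvq -map_poly_comp; apply/eqP; rewrite -[RHS]R0; congr _.[_].
    by apply: eq_map_poly => x /=; rewrite rmorph_int.
  apply: contraLR => nz; rewrite gtNdvdp //.
  have -> : size q = size 'Phi_N.
    rewrite -(size_map_poly (ratr : rat -> algC)) -Dq (minCpoly_cyclotomic epsP).
    by rewrite -(Cintr_Cyclotomic epsP) size_map_inj_poly // => a b /intr_inj.
  rewrite size_map_inj_poly //.
  by rewrite Pdiv.Ring.ltn_rmodpN0 ?monic_neq0.
rewrite DF R00 addr0 rmorphM hornerM.
by rewrite (rootP x0P) mulr0.
Qed.

End Reduction.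

(** * Finite fields: primitive elements, roots of cyclotomic polynomials, the trace *)

Lemma finField_expr_pred_card (E : finFieldType) (x : E) : x != 0 -> x ^+ #|E|.-1 = 1.
Proof.
move=> x0; have := expf_card x.
rewrite -[in LHS](prednK (ltnW (finNzRing_gt1 E))) exprS => /eqP.
by rewrite -[X in _ == X]mulr1 => /eqP/(mulfI x0).
Qed.

Lemma finField_prim_root (E : finFieldType) : exists x : E, #|E|.-1.-primitive_root x.
Proof.
have q1 : (1 < #|E|)%N := finNzRing_gt1 E.
have q0 : (0 < #|E|.-1)%N by rewrite -ltnS prednK // ltnW.
pose rs := [seq x <- enum E | x != 0].
suff /hasP[x _ hx] : has #|E|.-1.-primitive_root rs by exists x.
apply: has_prim_root => //.
- apply/allP => x; rewrite mem_filter => /andP[x0 _].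
  by rewrite unity_rootE finField_expr_pred_card.
- by rewrite filter_uniq ?enum_uniq.
- rewrite size_filter -(leq_add2l (count_mem 0 (enum E))).
  rewrite (count_predC (pred1 0)) count_uniq_mem ?enum_uniq // mem_enum inE -cardE.
  by rewrite add1n prednK // ltnW.
Qed.

(** In characteristic l the l-th roots of unity collapse to 1, so an element of order m is the right
    image for a complex root of unity of order l m. This supplies the hypothesis of
    [reduces_fun]. *)
Lemma root_Cyclotomic_pchar (E : fieldType) (l m : nat) (x : E) :
  l \in [pchar E] -> coprime l m -> m.-primitive_root x ->
  root (map_poly intr 'Phi_(l * m)) x.
Proof.
move=> lE co prim_x.
have l_pr : prime l := pcharf_prime lE.
have m0 := prim_order_gt0 prim_x.
have lm0 : (0 < l * m)%N by rewrite muln_gt0 prime_gt0.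
pose D := [seq d <- divisors (l * m) | ~~ (d %| m)%N].
have Xm0 : ('X^m - 1 : {poly int}) != 0 by rewrite monic_neq0 // monicXnsubC.
(* At x the left side is 1 + x^m + ... + x^(m (l - 1)) = l = 0. *)
have Q_eq : \prod_(d <- D) 'Phi_d = \sum_(i < l) 'X^m ^+ i :> {poly int}.
  apply: (mulfI Xm0); rewrite -subrX1 -exprM (mulnC m) -!prod_Cyclotomic //.
  rewrite [RHS](bigID (fun d => d %| m)%N) /= big_filter; congr (_ * _).
  rewrite -[RHS]big_filter; apply: perm_big; apply: uniq_perm.
  - exact: divisors_uniq.
  - by rewrite filter_uniq ?divisors_uniq.
  - move=> d; rewrite mem_filter -!dvdn_divisors //.
    by case: (boolP (d %| m)%N) => //= /dvdn_mull ->.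
have : root (map_poly intr (\prod_(d <- D) 'Phi_d)) x.
  rewrite Q_eq rootE rmorph_sum horner_sum /= (eq_bigr (fun=> 1)).
    by rewrite sumr_const card_ord (pcharf0 lE).
  move=> i _; rewrite rmorphXn /= map_polyXn horner_exp hornerXn.
  by rewrite (prim_expr_order prim_x) expr1n.
rewrite rmorph_prod /= rootE horner_prod prodf_seq_eq0 => /hasP[d].
rewrite mem_filter -dvdn_divisors //= => /andP[ndm dlm] rd.
(* A factor Phi_d vanishing at x forces x^d = 1, hence m | d. As d | l m but not d | m, only d = l m
   is left. *)
have xd : x ^+ d = 1.
  have d0 : (0 < d)%N by apply: dvdn_gt0 dlm.
  apply/eqP; rewrite -subr_eq0; apply/eqP.
  transitivity (map_poly intr ('X^d - 1 : {poly int})).[x].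
    by rewrite rmorphB /= map_polyXn rmorph1 !hornerE.
  rewrite -prod_Cyclotomic // (big_rem d) /= -?dvdn_divisors //.
  by rewrite rmorphM hornerM (eqP rd) mul0r.
have /dvdnP[e De] : (m %| d)%N by rewrite (prim_order_dvd prim_x) xd.
move: dlm ndm rd; rewrite De dvdn_pmul2r // => /(prime_nt_dvdP l_pr) el.
case: (eqVneq e 1%N) => [-> | e1]; first by rewrite mul1n dvdnn.
by rewrite (el e1) rootE.
Qed.

Section Trace.

Variables (l f : nat) (E : finFieldType).
Hypotheses (lE : l \in [pchar E]) (cardE : #|E| = (l ^ f)%N) (f0 : (0 < f)%N).

Let l_pr : prime l := pcharf_prime lE.
Let l0 : (0 < l)%N := prime_gt0 l_pr.

Lemma sum_expr_nz (k : nat) :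
  \sum_(x : E | x != 0) x ^+ k = if (#|E|.-1 %| k)%N then -1 else 0.
Proof.
have [g prim_g] := finField_prim_root E.
have g0 : g != 0 by rewrite (prim_root_eq0 prim_g) -lt0n (prim_order_gt0 prim_g).
case: ifP => [/dvdnP[e ->] | ndk].
  rewrite (eq_bigr (fun=> 1)) => [|x x0]; last first.
    by rewrite mulnC exprM (finField_expr_pred_card x0) expr1n.
  apply/eqP; rewrite -addr_eq0 addrC.
  have -> : 1 + \sum_(x : E | x != 0) 1 = \sum_(x : E) 1 :> E by rewrite [RHS](bigD1 0).
  by rewrite sumr_const cardE natrX (pcharf0 lE) expr0n gtn_eqF.
have gk : g ^+ k - 1 != 0 by rewrite subr_eq0 -(prim_order_dvd prim_g) ndk.
apply: (mulfI gk); rewrite mulr0 mulrBl mul1r; apply/eqP; rewrite subr_eq0; apply/eqP.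
rewrite [in RHS](reindex_inj (mulfI g0)) /= big_distrr /=.
apply: eq_big => [x | x _]; first by rewrite mulf_eq0 (negbTE g0).
by rewrite exprMn.
Qed.

Lemma pchar_exprD (i : nat) (x y : E) : (x + y) ^+ (l ^ i) = x ^+ (l ^ i) + y ^+ (l ^ i).
Proof.
elim: i x y => [|i IHi] x y; first by rewrite !expr1.
by rewrite !expnSr !exprM IHi -!(pFrobenius_autE lE) rmorphD.
Qed.

Definition ftrace (x : E) : E := \sum_(i < f) x ^+ (l ^ i).

Lemma ftraceD x y : ftrace (x + y) = ftrace x + ftrace y.
Proof. by rewrite -big_split; apply: eq_bigr => i _; rewrite pchar_exprD. Qed.

Lemma ftrace_frob x : ftrace (x ^+ l) = ftrace x.
Proof.
rewrite /ftrace; case: f f0 cardE => // f' _ cE.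
rewrite big_ord_recr big_ord_recl /= addrC -exprM -expnS -cE expf_card expr1.
by congr (_ + _); apply: eq_bigr => i _; rewrite -exprM -expnS.
Qed.

Lemma ftrace_pchar x : ftrace x ^+ l = ftrace x.
Proof.
rewrite -[RHS]ftrace_frob -(pFrobenius_autE lE) /ftrace rmorph_sum /=.
by apply: eq_bigr => i _; rewrite pFrobenius_autE -!exprM mulnC.
Qed.

Lemma natr_pchar_inj (m n : nat) : (m < l)%N -> (n < l)%N -> m%:R = n%:R :> E -> m = n.
Proof.
move=> ml nl; wlog le_mn : m n ml nl / (m <= n)%N.
  by move=> W; case/orP: (leq_total m n) => h e; [|apply/esym]; apply: W.
move=> /esym/eqP; rewrite -subr_eq0 -natrB // -(dvdn_pcharf lE) => d.
apply/eqP; rewrite eqn_leq le_mn -subn_eq0; apply: contraLR d => nz.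
by rewrite gtnNdvd ?lt0n //; apply: leq_ltn_trans nl; apply: leq_subr.
Qed.

(** The images of the integers below l are already l roots of X^l - X; a further root would exceed
    its degree. *)
Lemma prime_subfield (y : E) : y ^+ l = y -> exists i : 'I_l, i%:R == y.
Proof.
move=> yl; apply/existsP; apply/contraT; rewrite negb_exists => /forallP nex.
pose rs := y :: [seq (nat_of_ord i)%:R | i <- enum 'I_l] : seq E.
have Xl : ('X^l - 'X : {poly E}) != 0.
  by rewrite -size_poly_eq0 size_polyDl ?size_polyN ?size_polyXn ?size_polyX ?ltnS ?prime_gt1.
have := max_poly_roots Xl (rs := rs).
rewrite size_polyDl ?size_polyN ?size_polyXn ?size_polyX ?ltnS ?prime_gt1 //.
rewrite /= size_map size_enum_ord ltnn; apply.
  rewrite rootE !hornerE yl subrr eqxx /=; apply/allP => _ /mapP[i _ ->].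
  by rewrite rootE !hornerE -(pFrobenius_autE lE) rmorph_nat subrr.
apply/andP; split.
  by apply/mapP => -[i _ yi]; have := nex i; rewrite -yi eqxx.
by rewrite map_inj_uniq ?enum_uniq // => i j /natr_pchar_inj h; apply: val_inj; apply: h.
Qed.

(** A natural number lifting the trace, so that a complex l-th root of unity can be raised to it.
    The fallback 0 is never reached, since the trace lies in the prime field. *)
Definition ntrace (x : E) : nat := if [pick i : 'I_l | i%:R == ftrace x] is Some i then i else 0%N.

Lemma ntraceP x : (ntrace x)%:R = ftrace x.
Proof.
rewrite /ntrace; case: pickP => [i /eqP // | no].
by have [i hi] := prime_subfield (ftrace_pchar x); rewrite no in hi.
Qed.

Lemma ntrace_mod x (m : nat) : m%:R = ftrace x -> (ntrace x = m %[mod l])%N.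
Proof.
rewrite -ntraceP => h; apply: natr_pchar_inj; rewrite ?ltn_mod //.
have modl k : (k %% l)%:R = k%:R :> E.
  by rewrite [in RHS](divn_eq k l) natrD natrM (pcharf0 lE) mulr0 add0r.
by rewrite !modl h.
Qed.

(** Only the term x^-1 * x of the trace contributes: for 0 < i < f the exponent l^i - 1 lies
    strictly between 0 and l^f - 1. The value makes psi nontrivial and is the leading coefficient of
    [gauss 1]. *)
Lemma sum_inv_ftrace : \sum_(x : E | x != 0) x^-1 * ftrace x = -1.
Proof.
have step i : \sum_(x : E | x != 0) x^-1 * x ^+ (l ^ i) = \sum_(x : E | x != 0) x ^+ (l ^ i).-1.
  apply: eq_bigr => x x0; rewrite -[in LHS](prednK (_ : 0 < l ^ i)%N) ?expn_gt0 ?l0 //.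
  by rewrite exprS mulKf.
rewrite /ftrace; under eq_bigr => x _ do rewrite big_distrr /=.
rewrite exchange_big /=; under eq_bigr => i _ do rewrite step.
case: f f0 cardE => // f' _ cE; rewrite big_ord_recl sum_expr_nz expn0 dvdn0.
rewrite big1 ?addr0 // => i _; rewrite sum_expr_nz cE gtnNdvd //.
  rewrite -ltnS prednK ?expn_gt0 ?l0 //.
  by rewrite -(expn0 l) ltn_exp2l ?prime_gt1.
rewrite -ltnS !prednK ?expn_gt0 ?l0 //.
  by rewrite ltn_exp2l ?prime_gt1 // ltnS /bump /= add1n.
Qed.

End Trace.
(** Take a number field, Galois over Q, that contains e. Its automorphisms all extend to algC, so
    the value is fixed by the Galois group. *)
Lemma fixed_Crat N (e : algC) (F : {poly int}) :
  (0 < N)%N -> e ^+ N = 1 ->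
  (forall nu : {rmorphism algC -> algC}, nu (map_poly intr F).[e] = (map_poly intr F).[e]) ->
  (map_poly intr F).[e] \in Crat.
Proof.
case: N => // N _ eN fixF.
(* The group 'I_N.+1 serves only through its order: the field comes with a primitive root of unity
   of that order. *)
have [Qn galQn [QnC gQnC [w [prim_w _] _]]] := group_num_field_exists [set: 'I_N.+1].
rewrite cardsT card_ord in prim_w.
have prim_w' : N.+1.-primitive_root (QnC w) by rewrite fmorph_primitive_root.
have [i De] := prim_rootP prim_w' eN.
pose a := (map_poly intr F).[w ^+ i] : Qn.
have Da : QnC a = (map_poly intr F).[e].
  rewrite De -rmorphXn -horner_map -map_poly_comp; congr _.[_].
  by apply: eq_map_poly => x /=; rewrite rmorph_int.
have : a \in fixedField 'Gal({:Qn} / 1)%g.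
  apply/fixedFieldP; first exact: memvf.
  move=> x _; apply: (fmorph_inj QnC).
  have [nu Dnu] := gQnC x.
  by rewrite Dnu Da fixF.
rewrite (galois_fixedField galQn) => /vlineP[c Dc].
by rewrite -Da Dc alg_num_field fmorph_rat; apply: Crat_rat.
Qed.

(** * Gauss sums *)

Section GaussSum.

Variables (l f : nat) (E : finFieldType) (eps : algC) (x0 : E).
Hypotheses (lE : l \in [pchar E]) (cardE : #|E| = (l ^ f)%N) (f0 : (0 < f)%N).
Let q1 := #|E|.-1.
Hypotheses (q1_gt1 : (1 < q1)%N).
Hypothesis epsP : (l * q1).-primitive_root eps.
Hypothesis x0P : root (map_poly intr 'Phi_(l * q1)) x0.
Hypothesis x0_prim : q1.-primitive_root x0.

Let l_pr : prime l := pcharf_prime lE.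
Let l0 : (0 < l)%N := prime_gt0 l_pr.
Let q1_gt0 : (0 < q1)%N := ltnW q1_gt1.
Let cardE1 : #|E| = q1.+1.
Proof. by rewrite prednK // ltnW // finNzRing_gt1. Qed.

Notation red := (reduces eps x0).
Notation psi_nat := (ntrace l f).

Definition omega := eps ^+ l.
Definition zeta := eps ^+ q1.

Let omega_prim : q1.-primitive_root omega.
Proof. by have := dvdn_prim_root epsP (dvdn_mull l (dvdnn q1)); rewrite mulnK. Qed.

Let zeta_prim : l.-primitive_root zeta.
Proof. by have := dvdn_prim_root epsP (dvdn_mulr q1 (dvdnn l)); rewrite mulKn. Qed.

Let co_l : coprime l q1.
Proof.
rewrite prime_coprime //; apply/negP => d.
have : (l %| q1.+1)%N by rewrite -cardE1 cardE dvdn_exp.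
by rewrite -addn1 dvdn_addr // dvdn1 => /eqP le1; move: l_pr; rewrite le1.
Qed.

(** The inverse of the reduction of [omega]. Logarithms to this base make [kappa x] reduce to
    x^-1. *)
Let y0 := (x0 ^+ l)^-1.

Let y0_prim : q1.-primitive_root y0.
Proof.
have h : q1.-primitive_root (x0 ^+ l) by rewrite (prim_root_exp_coprime _ x0_prim).
have -> : y0 = (x0 ^+ l) ^+ q1.-1.
  have nz : x0 ^+ l != 0 by rewrite (prim_root_eq0 h) gtn_eqF.
  by apply: (mulfI nz); rewrite divff // -exprS prednK // (prim_expr_order h).
rewrite (prim_root_exp_coprime _ h); case: (q1) q1_gt0 => //= n _.
exact: coprimenS.
Qed.

(** The fallback is taken only at x = 0 and gives [kappa 0] the value 1 instead of 0; the character
    sums therefore exclude 0 explicitly. *)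
Definition flog (x : E) : nat := if [pick i : 'I_q1 | y0 ^+ i == x] is Some i then i else 0%N.

Lemma flogP x : x != 0 -> y0 ^+ flog x = x.
Proof.
move=> nz; rewrite /flog; case: pickP => [i /eqP // | no].
have [i hi] := prim_rootP y0_prim (finField_expr_pred_card nz).
by have := no i; rewrite -hi eqxx.
Qed.

(* The inverse of the Teichmueller character: kappa x reduces to x^-1 (reduces_kappa). *)
Definition kappa (x : E) := omega ^+ flog x.

Lemma kappaE x (i : nat) : y0 ^+ i = x -> kappa x = omega ^+ i.
Proof.
move=> h; have nx : x != 0 by rewrite -h expf_neq0 // (prim_root_eq0 y0_prim) gtn_eqF.
apply/eqP; rewrite (eq_prim_root_expr omega_prim) -(eq_prim_root_expr y0_prim).
by rewrite flogP // h.
Qed.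

Lemma kappaM x y : x != 0 -> y != 0 -> kappa (x * y) = kappa x * kappa y.
Proof.
by move=> nx ny; rewrite -exprD; apply: kappaE; rewrite exprD !flogP.
Qed.

Lemma kappa1 : kappa 1 = 1.
Proof. by rewrite (@kappaE 1 0%N) // expr0. Qed.

Lemma kappaX x n : x != 0 -> kappa (x ^+ n) = kappa x ^+ n.
Proof.
move=> nx; elim: n => [|n IHn]; first by rewrite !expr0 kappa1.
by rewrite !exprS kappaM ?expf_neq0 ?IHn.
Qed.

Lemma kappa_order x : kappa x ^+ q1 = 1.
Proof. by rewrite exprAC (prim_expr_order omega_prim) expr1n. Qed.

Lemma kappaV x : x != 0 -> kappa x^-1 * kappa x = 1.
Proof. by move=> nx; rewrite -kappaM ?invr_eq0 // mulVf // kappa1. Qed.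

Lemma reduces_kappa x : x != 0 -> red (kappa x) x^-1.
Proof.
move=> nx; rewrite -{2}(flogP nx) -exprVn invrK.
by do 2!apply: reducesX; apply: reduces_eps.
Qed.

Definition psi (x : E) := zeta ^+ ntrace l f x.

Lemma psiD x y : psi (x + y) = psi x * psi y.
Proof.
rewrite -exprD; apply/eqP; rewrite (eq_prim_root_expr zeta_prim); apply/eqP.
by apply: (ntrace_mod lE); rewrite // natrD !ntraceP // ftraceD.
Qed.

Lemma psi_frob x : psi (x ^+ l) = psi x.
Proof.
apply/eqP; rewrite (eq_prim_root_expr zeta_prim); apply/eqP.
by apply: (ntrace_mod lE); rewrite // ntraceP // (ftrace_frob cardE f0).
Qed.

Lemma reduces_zeta : red zeta 1.
Proof. by have := reducesX q1 (reduces_eps eps x0); rewrite (prim_expr_order x0_prim). Qed.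

Lemma reduces_psi x : red (psi x) 1.
Proof. by rewrite -(expr1n E (ntrace l f x)); apply: reducesX; apply: reduces_zeta. Qed.

(* The term x = 0 is left out even for trivial characters, so that gauss 0 = -1. *)
Definition gauss (m : nat) := \sum_(x : E | x != 0) kappa x ^+ m * psi x.

Lemma gauss_mod m m' : (m = m' %[mod q1])%N -> gauss m = gauss m'.
Proof.
move=> h; apply: eq_bigr => x _; congr (_ * _).
by rewrite -(expr_mod m (kappa_order x)) h (expr_mod m' (kappa_order x)).
Qed.

(** Frobenius permutes the field and preserves psi. Multiplying the exponent by l is thus free,
    which the digit argument exploits. *)
Lemma gauss_frob m : gauss (l * m) = gauss m.
Proof.
have inj : injective (fun x : E => x ^+ l).
  by move=> x y; rewrite -!(pFrobenius_autE lE) => /fmorph_inj.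
rewrite [in RHS]/gauss (reindex_inj inj) /=.
apply: eq_big => [x | x nx]; first by rewrite expf_eq0 l0.
by rewrite psi_frob kappaX // exprM.
Qed.

(** If psi were trivial, all traces would vanish, against [sum_inv_ftrace]. *)
Lemma psi_nontrivial : exists c, psi c != 1.
Proof.
apply/existsP; apply: contraT; rewrite negb_exists => /forallP h.
have /eqP := sum_inv_ftrace lE cardE f0.
rewrite big1 ?(eq_sym 0) ?oppr_eq0 ?oner_eq0 // => x _.
have := h x; rewrite negbK -(prim_order_dvd zeta_prim) (dvdn_pcharf lE).
by rewrite ntraceP // => /eqP ->; rewrite mulr0.
Qed.

Lemma sum_psi : \sum_(x : E) psi x = 0.
Proof.
have [c hc] := psi_nontrivial.
have nc : psi c - 1 != 0 by rewrite subr_eq0.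
apply: (mulfI nc); rewrite mulr0 mulrBl mul1r; apply/eqP; rewrite subr_eq0; apply/eqP.
rewrite [in RHS](reindex_inj (addrI c)) /= big_distrr /=.
by apply: eq_bigr => x _; rewrite psiD.
Qed.

Lemma psi0 : psi 0 = 1.
Proof.
have nz : psi 0 != 0 by rewrite expf_neq0 // (prim_root_eq0 zeta_prim) gtn_eqF.
by apply: (mulfI nz); rewrite -psiD addr0 mulr1.
Qed.

Lemma gauss0 m : (q1 %| m)%N -> gauss m = -1.
Proof.
move=> /dvdnP[k ->]; rewrite /gauss; apply/eqP; rewrite -addr_eq0 addrC; apply/eqP.
rewrite -[RHS]sum_psi [RHS](bigD1 0) //= psi0; congr (_ + _); apply: eq_bigr => x _.
by rewrite mulnC exprM kappa_order expr1n mul1r.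
Qed.

Lemma sum_kappa m : \sum_(x : E | x != 0) kappa x ^+ m = if (q1 %| m)%N then q1%:R else 0.
Proof.
case: ifP => [/dvdnP[k ->] | nd].
  rewrite (eq_bigr (fun=> 1)) => [|x _]; last by rewrite mulnC exprM kappa_order expr1n.
  rewrite sumr_const; congr (_ *+ _).
  by have := cardC1 (0 : E); rewrite cardE1 /= => <-; apply: eq_card.
have y00 : y0 != 0 by rewrite (prim_root_eq0 y0_prim) gtn_eqF.
have nc : kappa y0 ^+ m - 1 != 0.
  by rewrite (@kappaE y0 1) // expr1 subr_eq0 -(prim_order_dvd omega_prim) nd.
apply: (mulfI nc); rewrite mulr0 mulrBl mul1r; apply/eqP; rewrite subr_eq0; apply/eqP.
rewrite [in RHS](reindex_inj (mulfI y00)) /= big_distrr /=.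
apply: eq_big => [x | x nx]; first by rewrite mulf_eq0 (negbTE y00).
by rewrite kappaM // exprMn.
Qed.

Lemma gauss_twist m c : c != 0 ->
  \sum_(x : E | x != 0) kappa x ^+ m * psi (c * x) = kappa c^-1 ^+ m * gauss m.
Proof.
move=> nc; rewrite [in RHS]/gauss [in RHS](reindex_inj (mulfI nc)) /= [in RHS]big_distrr /=.
apply: eq_big => [x | x nx]; first by rewrite mulf_eq0 (negbTE nc).
by rewrite kappaM // exprMn !mulrA -exprMn kappaV // expr1n mul1r.
Qed.

(** Write the second variable as x t. For t != -1 the sum over x is a twisted Gauss sum, which
    leaves a Jacobi sum over t; for t = -1 the additive character disappears and a pure character
    sum remains. *)
Lemma gauss_mul a b :
  gauss a * gauss b =
  (\sum_(t : E | (t != 0) && (t != -1)) kappa t ^+ b * kappa (1 + t)^-1 ^+ (a + b)) * gauss (a + b)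
   + kappa (-1) ^+ b * (if (q1 %| a + b)%N then q1%:R else 0).
Proof.
have step (x t : E) : x != 0 -> t != 0 ->
    kappa x ^+ a * psi x * (kappa (x * t) ^+ b * psi (x * t))
    = kappa t ^+ b * (kappa x ^+ (a + b) * psi ((1 + t) * x)).
  move=> nx nt; rewrite kappaM // exprMn mulrDl mul1r psiD (mulrC t) exprD.
  ring.
rewrite {1}/gauss big_distrl /=.
under eq_bigr => x nx.
  rewrite /gauss (reindex_inj (mulfI nx)) /= big_distrr /=.
  rewrite (eq_bigl (fun t => t != 0)) => [|t]; last by rewrite mulf_eq0 (negbTE nx).
  under eq_bigr => t nt do rewrite step //.
  over.
rewrite exchange_big /= (bigD1 (-1)) /=; last by rewrite oppr_eq0 oner_eq0.
rewrite addrC; congr (_ + _).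
  rewrite big_distrl /=; apply: eq_bigr => t /andP[nt nt1].
  by rewrite -big_distrr /= gauss_twist ?mulrA // addrC -(opprK 1) subr_eq0.
rewrite subrr -big_distrr /= -sum_kappa; congr (_ * _); apply: eq_bigr => x _.
by rewrite mul0r psi0 mulr1.
Qed.

(** When the exponents add up to 0 modulo q1, the extra term is absorbed into J because the trivial
    Gauss sum is -1. *)
Lemma gauss_mul_dvd a b : exists J y, red J y /\ gauss a * gauss b = J * gauss (a + b).
Proof.
pose J := (\sum_(t : E | (t != 0) && (t != -1)) kappa t ^+ b * kappa (1 + t)^-1 ^+ (a + b))
   - kappa (-1) ^+ b * (if (q1 %| a + b)%N then q1%:R else 0).
exists J; suff [y hy] : exists y, red J y.
  exists y; split=> //; rewrite gauss_mul mulrBl; congr (_ + _); case: ifP => h.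
    by rewrite gauss0 // mulrN1 opprK.
  by rewrite mulr0 mul0r oppr0.
have [y1 h1] : exists y, red (\sum_(t : E | (t != 0) && (t != -1))
      kappa t ^+ b * kappa (1 + t)^-1 ^+ (a + b)) y.
  apply: reduces_ex_sum => t /andP[nt nt1]; eexists.
  apply: reducesM; apply: reducesX; apply: reduces_kappa => //.
  by rewrite invr_eq0 addrC -(opprK 1) subr_eq0.
have [y2 h2] : exists y, red (if (q1 %| a + b)%N then q1%:R else 0) y.
  by case: ifP => _; eexists; [apply: reduces_nat | apply: reduces0].
eexists; apply: reducesB; first exact: h1.
apply: reducesM h2.
by apply: reducesX; apply: reduces_kappa; rewrite oppr_eq0 oner_eq0.
Qed.

(** Here the Jacobi sum lacks only t = -1 from a vanishing character sum, so it is - kappa(-1)^b.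
    Multiplied by the trivial Gauss sum -1 it contributes kappa(-1)^b, besides q1 times the same
    from t = -1. *)
Lemma gauss_norm a b : ~~ (q1 %| b)%N -> (q1 %| a + b)%N ->
  gauss a * gauss b = kappa (-1) ^+ b * #|E|%:R.
Proof.
move=> nb dab; rewrite gauss_mul dab gauss0 // mulrN1 cardE1 -addn1 natrD mulrDr mulr1 addrC.
congr (_ + _); have N10 : -1 != 0 :> E by rewrite oppr_eq0 oner_eq0.
have := sum_kappa b; rewrite (negbTE nb) (bigD1 (-1)) //= => /eqP; rewrite addr_eq0 => /eqP ->.
congr (- _); apply: eq_bigr => t /andP[nt nt1]; have /dvdnP[k ->] := dab.
by rewrite (mulnC k) exprM kappa_order expr1n mulr1.
Qed.

Lemma natl_neq0 k : (0 < k < l)%N -> k%:R != 0 :> E.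
Proof. by move=> /andP[k0 kl]; rewrite -(dvdn_pcharf lE) gtnNdvd. Qed.

(* gauss 1 is zeta - 1 times an integer reducing to sum_x x^-1 Tr(x) = -1, and (zeta - 1)^(l - 1) is
   l up to elements with nonzero reduction. *)
Lemma gauss1_pow : exists u yu v yv,
  [/\ red u yu, yu != 0, red v yv, yv != 0 & gauss 1 ^+ l.-1 * v = l%:R * u].
Proof.
pose u := \sum_(x : E | x != 0) kappa x * \sum_(i < ntrace l f x) zeta ^+ i.
have Dg : gauss 1 = (zeta - 1) * u.
  (* As 1 < q1, the character kappa is nontrivial and sums to 0, so 1 may be subtracted from psi. *)
  transitivity (\sum_(x : E | x != 0) kappa x * (psi x - 1)).
    under [RHS]eq_bigr => x _ do rewrite mulrBr mulr1.
    rewrite sumrB; have := sum_kappa 1; rewrite gtnNdvd //.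
    by under eq_bigr => x _ do rewrite expr1; move=> ->; rewrite subr0; apply: eq_bigr => x _; rewrite expr1.
  rewrite big_distrr; apply: eq_bigr => x _ /=.
  by rewrite mulrCA /psi subrX1.
have ru : red u (-1).
  rewrite -(sum_inv_ftrace lE cardE f0); apply: reduces_sum => x nx.
  apply: reducesM; first exact: reduces_kappa.
  rewrite -(ntraceP lE cardE f0) -[X in X%:R]card_ord -sumr_const; apply: reduces_sum => i _.
  by rewrite -(expr1n E i); apply: reducesX; apply: reduces_zeta.
(* Each 1 - zeta^k is zeta - 1 times minus a geometric sum reducing to k, which is nonzero for 0 < k
   < l; the product of the 1 - zeta^k is l. *)
pose v := \prod_(1 <= k < l) - \sum_(i < k) zeta ^+ i.
have rv : red v (\prod_(1 <= k < l) - k%:R).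
  apply: reduces_prod => k _; apply: reducesN.
  rewrite -[X in X%:R]card_ord -sumr_const; apply: reduces_sum => i _.
  by rewrite -(expr1n E i); apply: reducesX; apply: reduces_zeta.
have Dl : l%:R = (zeta - 1) ^+ l.-1 * v.
  have -> : l%:R = \prod_(1 <= k < l) (1 - zeta ^+ k).
    have X10 : 'X - 1%:P != 0 :> {poly algC} by rewrite polyXsubC_eq0.
    have := factor_Xn_sub_1 zeta_prim; rewrite big_ltn // expr0 => D.
    have {}D : \prod_(1 <= k < l) ('X - (zeta ^+ k)%:P) = \sum_(i < l) 'X^i.
      by apply: (mulfI X10); rewrite D subrX1.
    transitivity (\sum_(i < l) 'X^i : {poly algC}).[1].
      rewrite horner_sum (eq_bigr (fun=> 1)) ?sumr_const ?card_ord // => i _.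
      by rewrite hornerXn expr1n.
    by rewrite -D horner_prod; apply: eq_bigr => k _; rewrite !hornerE.
  rewrite /v -(subn1 l) -[in RHS]prodr_const_nat -big_split.
  by apply: eq_bigr => k _ /=; rewrite mulrN -subrX1 opprB.
exists (u ^+ l.-1), ((-1) ^+ l.-1), v, (\prod_(1 <= k < l) - k%:R); split => //.
- exact: reducesX.
- by rewrite expf_neq0 // oppr_eq0 oner_eq0.
- rewrite prodf_seq_neq0; apply/allP => k; rewrite mem_index_iota /= => hk.
  by rewrite oppr_eq0 natl_neq0.
- by rewrite Dg exprMn mulrAC Dl.
Qed.

End GaussSum.

(** * The quadratic character *)

Section QuadraticCharacter.

Variable p : nat.
Hypotheses (p_pr : prime p) (p3 : p = 3 %[mod 4]).

Let m := (p.-1)./2.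

Lemma odd_half_pred : odd (p.-1)./2.
Proof. by have := prime_gt1 p_pr; move: p3; lia. Qed.

Lemma double_half_pred : (m * 2 = p.-1)%N.
Proof. by have := prime_gt1 p_pr; move: p3; rewrite /m; lia. Qed.

Lemma Fp_expr (x : 'F_p) : x != 0 -> x ^+ p.-1 = 1.
Proof. by move=> /finField_expr_pred_card; rewrite card_Fp. Qed.

Definition Fp_nat (x : 'F_p) : nat := val x.
Arguments Fp_nat : simpl never.

Lemma Fp_natK (x : 'F_p) : (Fp_nat x)%:R = x.
Proof. exact: natr_Zp. Qed.

Lemma Fp_nat_lt (x : 'F_p) : (Fp_nat x < p)%N.
Proof. by have := ltn_ord x; rewrite [X in (_ < X)%N]Fp_cast. Qed.

Lemma Fp_nat_natr (n : nat) : Fp_nat (n%:R : 'F_p) = (n %% p)%N.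
Proof. exact: val_Fp_nat. Qed.

Lemma Fp_nat_gt0 (x : 'F_p) : x != 0 -> (0 < Fp_nat x)%N.
Proof. by rewrite lt0n. Qed.

Lemma Fp_nat_opp (a : 'F_p) : a != 0 -> (Fp_nat a + Fp_nat (- a)%R = p)%N.
Proof.
move=> na; have na' : - a != 0 by rewrite oppr_eq0.
have : (p %| Fp_nat a + Fp_nat (- a)%R)%N.
  by rewrite (dvdn_pcharf (pchar_Fp p_pr)) natrD !Fp_natK subrr.
have := Fp_nat_gt0 na; have := Fp_nat_gt0 na'.
have := Fp_nat_lt a; have := Fp_nat_lt (- a).
clear; move: (Fp_nat a) (Fp_nat (- a)) => x y yp xp y0 x0' /dvdnP[[|[|k]] Dk]; nia.
Qed.

Lemma half_pred_lt : (m < p)%N.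
Proof. by have := prime_gt1 p_pr; rewrite /m; lia. Qed.

Lemma odd_eq_half : p = (2 * (p./2) + 1)%N.
Proof. by move: p3; lia. Qed.

Lemma quarter_succ : (4 * (p.+1 %/ 4) = p.+1)%N.
Proof. by move: p3; lia. Qed.

(** The Legendre symbol, with Euler's criterion taken as its definition. *)
Definition chi (x : 'F_p) : int := if x == 0 then 0 else if x ^+ m == 1 then 1 else -1.

Lemma half_expr (x : 'F_p) : x != 0 -> x ^+ m = 1 \/ x ^+ m = -1.
Proof.
move=> nx; have /eqP := Fp_expr nx; rewrite -double_half_pred exprM -subr_eq0 subr_sqr_1.
by rewrite mulf_eq0 subr_eq0 addr_eq0 => /orP[/eqP|/eqP]; [left | right].
Qed.

Lemma Fp_N1_neq1 : (-1 : 'F_p) != 1.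
Proof.
apply/eqP => h; have : (2%:R : 'F_p) == 0 by rewrite mulr2n -{1}h addNr.
rewrite -(dvdn_pcharf (pchar_Fp p_pr)) => /dvdn_leq => /(_ isT).
have := prime_gt1 p_pr; move: p3; lia.
Qed.

Lemma chi0 : chi 0 = 0. Proof. by rewrite /chi eqxx. Qed.

Lemma chi1 : chi 1 = 1. Proof. by rewrite /chi oner_eq0 expr1n eqxx. Qed.

Lemma chi_cases x : x != 0 -> chi x = 1 \/ chi x = -1.
Proof. by rewrite /chi => /negbTE ->; case: ifP; [left | right]. Qed.

Lemma chiP x : x != 0 -> (chi x == 1) = (x ^+ m == 1).
Proof. by rewrite /chi => /negbTE ->; case: ifP. Qed.

Lemma chiM x y : chi (x * y) = chi x * chi y.
Proof.
rewrite {1}/chi mulf_eq0; case: eqVneq => [-> | nx] /=; first by rewrite chi0 mul0r.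
case: eqVneq => [-> | ny] /=; first by rewrite chi0 mulr0.
rewrite exprMn /chi (negbTE nx) (negbTE ny).
by case: (half_expr nx) => ->; case: (half_expr ny) => ->;
  rewrite ?mul1r ?mulr1 ?mulrNN ?mul1r ?eqxx ?(negbTE Fp_N1_neq1).
Qed.

Lemma chiX x n : chi (x ^+ n) = chi x ^+ n.
Proof. by elim: n => [|n IHn]; [rewrite !expr0 chi1 | rewrite !exprS chiM IHn]. Qed.

Lemma chiN1 : chi (-1) = -1.
Proof.
rewrite /chi oppr_eq0 oner_eq0 -signr_odd odd_half_pred expr1.
by rewrite (negbTE Fp_N1_neq1).
Qed.

Lemma chiN x : chi (- x) = - chi x.
Proof. by rewrite -mulN1r chiM chiN1 mulN1r. Qed.

Lemma chi_sqr x : x != 0 -> chi x * chi x = 1.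
Proof. by move=> /chi_cases[] ->. Qed.

Lemma chi_prim_root g : p.-1.-primitive_root g -> chi g = -1.
Proof.
move=> pg; rewrite /chi (prim_root_eq0 pg) gtn_eqF ?(prim_order_gt0 pg) //.
rewrite -(prim_order_dvd pg) gtnNdvd //; first by have := odd_half_pred; rewrite -/m; case: (m).
by rewrite -double_half_pred; have := odd_half_pred; rewrite -/m; lia.
Qed.

Lemma sum_chi : \sum_x chi x = 0.
Proof.
have N10 : -1 != 0 :> 'F_p by rewrite oppr_eq0 oner_eq0.
suff : \sum_x chi x = - \sum_x chi x by lia.
rewrite [LHS](reindex_inj (mulfI N10)) -sumrN; apply: eq_bigr => x _.
by rewrite mulN1r chiN.
Qed.

Definition res_sum := (\sum_(x : 'F_p | chi x == 1%R) Fp_nat x)%N.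
Definition nres_sum := (\sum_(x : 'F_p | chi x == (-1)%R) Fp_nat x)%N.

Lemma Posz_sum I (r : seq I) (P : pred I) (F : I -> nat) :
  (\sum_(i <- r | P i) F i)%N%:Z = \sum_(i <- r | P i) (F i)%:Z.
Proof. exact: (big_morph Posz PoszD erefl). Qed.

Lemma chi_val_sum : \sum_x chi x * (Fp_nat x)%:Z = res_sum%:Z - nres_sum%:Z.
Proof.
rewrite (bigID (fun x => chi x == 1)) /= !Posz_sum; congr (_ + _).
  by apply: eq_bigr => x /eqP ->; rewrite mul1r.
rewrite (bigID (fun x => chi x == -1)) /= [X in _ + X]big1 ?addr0; last first.
  move=> x /andP[h1 h2]; have [-> | /chi_cases[] h] := eqVneq x 0; first by rewrite mulr0.
    by rewrite h in h1.
  by rewrite h in h2.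
rewrite -sumrN; apply: eq_big => [x | x /andP[_ /eqP ->]]; last by rewrite mulN1r.
by rewrite andbC; case: eqP => // ->.
Qed.

Lemma res_nres_sum : (res_sum + nres_sum = \sum_(x : 'F_p) Fp_nat x)%N.
Proof.
rewrite [RHS](bigID (fun x => chi x == 1)) /=; congr (_ + _)%N.
rewrite [RHS](bigD1 0) /= ?chi0 // add0n; apply: eq_bigl => x.
have [-> | nx] := eqVneq x 0; first by rewrite chi0.
by have [-> | ->] := chi_cases nx.
Qed.

Lemma sum_Fp_nat : (\sum_(x : 'F_p) Fp_nat x = p * m)%N.
Proof.
have -> : (\sum_(x : 'F_p) Fp_nat x = \sum_(0 <= i < (Zp_trunc (pdiv p)).+2) i)%N by rewrite big_mkord.
rewrite Fp_cast // bin2_sum bin2odd //.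
by have := prime_gt1 p_pr; move: p3; lia.
Qed.

Hypothesis p_neq3 : p != 3%N.

(** Multiplication by g^2 permutes the squares, hence fixes their sum in 'F_p. That g^2 != 1 needs p
    - 1 > 2, where p != 3 enters. *)
Lemma dvd_res_sum : (p %| res_sum)%N.
Proof.
rewrite (dvdn_pcharf (pchar_Fp p_pr)) natr_sum.
have [g pg] := finField_prim_root 'F_p; rewrite card_Fp // in pg.
have chig2 : chi (g ^+ 2) = 1 by rewrite chiX chi_prim_root.
have g21 : g ^+ 2 - 1 != 0.
  rewrite subr_eq0 -(prim_order_dvd pg) gtnNdvd //.
  by have := prime_gt1 p_pr; move: p3 p_neq3; lia.
have g20 : g ^+ 2 != 0 by rewrite expf_neq0 // (prim_root_eq0 pg) gtn_eqF ?(prim_order_gt0 pg).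
apply/eqP; apply: (mulfI g21); rewrite mulr0 mulrBl mul1r; apply/eqP; rewrite subr_eq0; apply/eqP.
rewrite [in RHS](reindex_inj (mulfI g20)) big_distrr.
apply: eq_big => [x | x _]; first by rewrite chiM chig2 mul1r.
by rewrite !Fp_natK.
Qed.

Lemma dvd_nres_sum : (p %| nres_sum)%N.
Proof. by rewrite -(dvdn_addr _ dvd_res_sum) res_nres_sum sum_Fp_nat dvdn_mulr. Qed.

(** The quotients for residues and nonresidues will turn out to be the exact valuations of
    [gauss_prod 1] and [gauss_prod (-1)] at the chosen place. *)
Definition res_quot := (res_sum %/ p)%N.
Definition nres_quot := (nres_sum %/ p)%N.
(** The generalized Bernoulli number B_{1,chi}. *)
Definition bernoulli : int := res_quot%:Z - nres_quot%:Z.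

Lemma bernoulli_sum : p%:Z * bernoulli = \sum_x chi x * (Fp_nat x)%:Z.
Proof.
rewrite chi_val_sum /bernoulli mulrBr -!PoszM mulnC (mulnC p).
by rewrite /res_quot /nres_quot !divnK ?dvd_res_sum ?dvd_nres_sum.
Qed.

Lemma quot_sum : (res_quot + nres_quot = m)%N.
Proof.
apply/eqP; rewrite -(eqn_pmul2l (prime_gt0 p_pr)) -sum_Fp_nat -res_nres_sum mulnDr.
by rewrite ![(p * _)%N]mulnC /res_quot /nres_quot !divnK ?dvd_res_sum ?dvd_nres_sum.
Qed.

(** The two quotients add up to (p - 1) / 2, which is odd, and a difference has the parity of the
    sum. *)
Lemma bernoulli_odd : odd `|bernoulli|%N.
Proof. by have := odd_half_pred; rewrite -/m -quot_sum /bernoulli; lia. Qed.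

Lemma chi_carry_sum (d : 'F_p) : 1 + d != 0 ->
  \sum_(x : 'F_p | (p < Fp_nat x + Fp_nat (d * x)%R)%N) chi x = (1 + chi d - chi (1 + d)) * bernoulli.
Proof.
move=> d1; have p0 : p%:Z != 0 by have := prime_gt0 p_pr; lia.
have twist (c : 'F_p) : \sum_x chi x * (Fp_nat (c * x))%:Z = chi c * (p%:Z * bernoulli).
  have [-> | nc] := eqVneq c 0.
    by rewrite chi0 mul0r big1 // => x _; rewrite mul0r mulr0.
  rewrite bernoulli_sum [in RHS](reindex_inj (mulfI nc)) [in RHS]big_distrr.
  by apply: eq_bigr => x _ /=; rewrite chiM !mulrA chi_sqr // mul1r.
apply: (mulfI p0); rewrite mulrCA mulrBl mulrDl -!twist mul1r bernoulli_sum -big_split -sumrB.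
rewrite big_mkcond big_distrr; apply: eq_bigr => x _ /=.
have [-> | nx] := eqVneq x 0; first by rewrite chi0 !mul0r if_same mulr0.
have hv : (Fp_nat ((1 + d) * x)%R = (Fp_nat x + Fp_nat (d * x)%R) %% p)%N.
  by rewrite -[in LHS](Fp_natK ((1 + d) * x)) -Fp_nat_natr natrD !Fp_natK mulrDl mul1r.
(* As 1 + d != 0, the representatives of x and d x never add up to exactly p, so the strict
   inequality detects precisely a carry. *)
have hne : Fp_nat ((1 + d) * x)%R != 0%N by rewrite -[_ != _]/((1 + d) * x != 0) mulf_neq0.
rewrite /= -mulrDr -mulrBr (mulrC (p%:Z)).
set a := Fp_nat x in hv *; set b := Fp_nat (d * x) in hv *.
set c := Fp_nat ((1 + d) * x) in hv hne *.
have [ap bp] : (a < p)%N /\ (b < p)%N by split; apply: Fp_nat_lt.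
case: ifP => h; last first.
  rewrite mul0r; have ab : (a + b < p)%N.
    have : (a + b)%N != p by apply/eqP => e; move: hne; rewrite hv e modnn.
    by move: h; lia.
  by rewrite hv modn_small // PoszD subrr mulr0.
have -> : c = (a + b - p)%N.
  by rewrite hv -{1}(subnK (ltnW h)) modnDr modn_small //; lia.
congr (_ * _); lia.
Qed.

End QuadraticCharacter.

(** * Stickelberger's theorem for Q(sqrt(-p)) *)

Lemma norm_rel_dvd (P X Y N : int) :
  P * X ^+ 2 + Y ^+ 2 = 4 * P * N -> Y ^+ 2 = (4 * N - X ^+ 2) * P.
Proof. by lia. Qed.

Lemma norm_rel_div (P X Z N : int) : P != 0 ->
  P * X ^+ 2 + (- P * Z) ^+ 2 = 4 * P * N -> X ^+ 2 + P * Z ^+ 2 = 4 * N.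
Proof.
move=> P0 h; apply: (mulfI P0); transitivity (4 * P * N); last by ring.
by rewrite -h; ring.
Qed.

(** Modulo 4 the relation reads X^2 = Z^2, so X and Z have the same parity. With eta = (sqrt(-P) -
    1) / 2, the number (X + Z sqrt(-P)) / 2 is A + Z eta. *)
Lemma half_sum_int (c P X Z N : int) : 4 * c = P + 1 ->
  X ^+ 2 + P * Z ^+ 2 = 4 * N -> exists A, X + Z = 2 * A /\ A ^+ 2 - A * Z + c * Z ^+ 2 = N.
Proof.
move=> Dc h; have DP : P = 4 * c - 1 by lia.
have [a Da] : exists a, X + Z = 2 * a.
  exists ((X + Z) %/ 2)%Z.
  have [a [Da|Da]] : exists a, X + Z = 2 * a \/ X + Z = 2 * a + 1 by exists ((X + Z) %/ 2)%Z; lia.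
    by lia.
  have DX : X = 2 * a + 1 - Z by lia.
  by exfalso; move: h; rewrite DX DP; lia.
exists a; split=> //; have DX : X = 2 * a - Z by lia.
by move: h; rewrite DX DP; lia.
Qed.

(* With c = (p + 1) / 4, A^2 - A B + c B^2 is the norm of A + B eta, for eta^2 + eta + c = 0. *)
Lemma norm_form_content (l c : nat) (A B : int) (m : nat) : prime l ->
  A ^+ 2 - A * B + c%:Z * B ^+ 2 = (l ^ m)%N%:Z ->
  exists k A' B', [/\ A = (l ^ k)%N%:Z * A', B = (l ^ k)%N%:Z * B',
    ~~ ((l%:Z %| A')%Z && (l%:Z %| B')%Z), (2 * k <= m)%N
    & A' ^+ 2 - A' * B' + c%:Z * B' ^+ 2 = (l ^ (m - 2 * k))%N%:Z].
Proof.
move=> l_pr; have [n] := ubnP m; elim: n => // n IHn in A B m *; rewrite ltnS => mn norm.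
have [/andP[/dvdzP[A1 DA] /dvdzP[B1 DB]] | nd] := boolP ((l%:Z %| A)%Z && (l%:Z %| B)%Z); last first.
  by exists 0%N, A, B; rewrite expn0 !mul1r muln0 subn0.
have l0 := prime_gt0 l_pr.
have {}norm : (l * l)%N%:Z * (A1 ^+ 2 - A1 * B1 + c%:Z * B1 ^+ 2) = (l ^ m)%N%:Z.
  by rewrite -norm DA DB PoszM; ring.
have m2 : (2 <= m)%N.
  have : (l ^ 2 %| l ^ m)%N.
    rewrite -mulnn; have := congr1 absz norm; rewrite abszM /= => <-; exact: dvdn_mulr.
  by rewrite dvdn_Pexp2l // prime_gt1.
have norm1 : A1 ^+ 2 - A1 * B1 + c%:Z * B1 ^+ 2 = (l ^ (m - 2))%N%:Z.
  have ll : (l * l)%N%:Z != 0 by rewrite eqz_nat muln_eq0 orbb -lt0n.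
  by apply: (mulfI ll); rewrite norm -PoszM mulnn -expnD subnKC.
have mn' : (m - 2 < n)%N by move: m2 mn; clear; lia.
have [k [A' [B' [DA' DB' nd km norm']]]] := IHn A1 B1 _ mn' norm1.
exists k.+1, A', B'; split => //.
- by rewrite DA DA' expnSr PoszM mulrAC.
- by rewrite DB DB' expnSr PoszM mulrAC.
- by move: km m2; clear; lia.
- by rewrite norm'; congr (Posz (l ^ _)); move: km m2; clear; lia.
Qed.

(** To be read with l^k the content and l^n the norm of the primitive part. The two bounds add up to
    the total, so k = b0 and k + n = b1. *)
Lemma two_sided_valuation (k n b0 b1 : nat) :
  (n + 2 * k = b0 + b1)%N -> (k <= b0)%N -> (k + n <= b1)%N -> n = `|b0%:Z - b1%:Z|%N.
Proof. by lia. Qed.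

Section Stickelberger.

Variables (p l f : nat) (E : finFieldType) (eps : algC) (x0 : E).
Hypotheses (p_pr : prime p) (p3 : p = 3 %[mod 4]) (p_neq3 : p != 3%N).
Hypotheses (lE : l \in [pchar E]) (cardE : #|E| = (l ^ f)%N).
Hypothesis f_prim : f.-primitive_root (l%:R : 'F_p).
Hypothesis epsP : (l * #|E|.-1).-primitive_root eps.
Hypothesis x0P : root (map_poly intr 'Phi_(l * #|E|.-1)) x0.
Hypothesis x0_prim : #|E|.-1.-primitive_root x0.

Let q1 := #|E|.-1.
Let f0 : (0 < f)%N := prim_order_gt0 f_prim.
Let l_pr : prime l := pcharf_prime lE.
Let l0 : (0 < l)%N := prime_gt0 l_pr.
Let p0 : (0 < p)%N := prime_gt0 p_pr.
Let q1_gt0 : (0 < q1)%N := prim_order_gt0 x0_prim.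
Let pF := pchar_Fp p_pr.
Let cardE1 : (l ^ f)%N = q1.+1.
Proof. by rewrite -cardE prednK // ltnW // finNzRing_gt1. Qed.

Let p_dvd_q1 : (p %| q1)%N.
Proof.
have : q1%:R + 1 = 1 :> 'F_p by rewrite natr1 -cardE1 natrX (prim_expr_order f_prim).
by move/eqP; rewrite (dvdn_pcharf pF) -subr_eq0 addrK.
Qed.

Let q1_gt1 : (1 < q1)%N.
Proof. exact: leq_trans (prime_gt1 p_pr) (dvdn_leq q1_gt0 p_dvd_q1). Qed.

Let M := (q1 %/ p)%N.
Let Mp : (M * p = q1)%N. Proof. exact: divnK. Qed.

Notation red := (reduces eps x0).
Notation G := (gauss l f eps x0).
Notation kap := (kappa l eps x0).
Let kapX := kappaX lE cardE f0 q1_gt1 epsP x0_prim.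
Let Gmod := @gauss_mod l f E eps x0 q1_gt1 epsP.
Let Gfrob := gauss_frob lE cardE f0 q1_gt1 epsP x0_prim.

Definition gaussp (a : 'F_p) := G (Fp_nat a * M).

Lemma gaussp_nat (n : nat) : G (n * M) = gaussp n%:R.
Proof.
apply: Gmod; rewrite Fp_nat_natr // {1}(divn_eq n p) mulnDl -mulnA (mulnC p) Mp.
by rewrite modnMDl.
Qed.

Lemma l_neq0 : l%:R != 0 :> 'F_p.
Proof. by rewrite (prim_root_eq0 f_prim) gtn_eqF. Qed.

Lemma gaussp_l a : gaussp (l%:R * a) = gaussp a.
Proof. by rewrite -{1}(Fp_natK a) -natrM -gaussp_nat -mulnA Gfrob. Qed.

Lemma gaussp_lX i a : gaussp (l%:R ^+ i * a) = gaussp a.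
Proof. by elim: i => [|i IHi]; rewrite ?mul1r // exprS -mulrA gaussp_l. Qed.

(* The base l digits of (l^f - 1) a / p are the ldigit (l^i a), 0 <= i < f. *)
Definition ldigit (a : 'F_p) : nat := ((l * Fp_nat a) %/ p)%N.

Lemma ldigitP a : (l * Fp_nat a = p * ldigit a + Fp_nat (l%:R * a)%R)%N.
Proof.
by rewrite {1}(divn_eq (l * Fp_nat a) p) mulnC -{4}(Fp_natK a) -natrM Fp_nat_natr.
Qed.

(** Having some reduction means that the cofactor J lies in Z[eps], so this is divisibility in that
    ring. *)
Definition gauss1_dvd (s m : nat) := exists J y, red J y /\ G 1 ^+ s = J * G m.

Lemma gauss1_dvd0 : gauss1_dvd 0 0.
Proof.
exists (-1), (-1); split; first exact: reducesN (reduces1 _ _).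
by rewrite expr0 (gauss0 x0 lE cardE f0 q1_gt1 epsP (dvdn0 _)) mulrNN mulr1.
Qed.

Lemma gauss1_dvdS s m : gauss1_dvd s m -> gauss1_dvd s.+1 m.+1.
Proof.
move=> [J [y [rJ DJ]]].
have [J' [y' [rJ' DJ']]] := gauss_mul_dvd lE cardE f0 q1_gt1 epsP x0_prim m 1.
exists (J * J'), (y * y'); split; first exact: reducesM.
by rewrite exprSr DJ -mulrA DJ' mulrA addn1.
Qed.

Lemma gauss1_dvdD s m n : gauss1_dvd s m -> gauss1_dvd (s + n) (m + n).
Proof.
by move=> h; elim: n => [|n IHn]; rewrite ?addn0 // !addnS; apply: gauss1_dvdS.
Qed.

(** Horner's scheme on the base l digits of the exponent: multiplying by l is free by [gauss_frob],
    and adding a digit costs as many factors [G 1]. *)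
Lemma gauss1_dvd_gaussp a :
  exists J y, red J y /\ G 1 ^+ (\sum_(i < f) ldigit (l%:R ^+ i * a)%R) = J * gaussp a.
Proof.
(* The invariant says that m is the quotient of l^n a by p. At n = f the remainder is a again, as
   l^f = 1 modulo p, so p m = (l^f - 1) a. *)
suff [m [Dm hm]] : exists m, (p * m + Fp_nat (l%:R ^+ f * a)%R = l ^ f * Fp_nat a)%N /\
    gauss1_dvd (\sum_(i < f) ldigit (l%:R ^+ i * a)%R) m.
  rewrite /gaussp; suff <- : m = (Fp_nat a * M)%N by [].
  move: Dm; rewrite (prim_expr_order f_prim) mul1r cardE1 mulSn addnC => /addnI.
  by rewrite -Mp mulnC mulnAC => /eqP; rewrite eqn_pmul2r // mulnC => /eqP.
elim: (f) => [|n [m [Dm hm]]].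
  exists 0%N; rewrite big_ord0 muln0 add0n mul1r mul1n; split=> //.
  exact: gauss1_dvd0.
exists (l * m + ldigit (l%:R ^+ n * a)%R)%N; split.
  rewrite [in RHS]expnS -[in RHS]mulnA -Dm mulnDr mulnDr ldigitP mulrA -exprS.
  by rewrite mulnCA addnA.
rewrite big_ord_recr; apply: gauss1_dvdD.
by have [J [y [rJ DJ]]] := hm; exists J, y; rewrite Gfrob.
Qed.

(** Sum the division identity [ldigitP] over a whole cycle: the remainders are the dividends' values
    shifted cyclically. *)
Lemma ldigit_sum a :
  (p * \sum_(i < f) ldigit (l%:R ^+ i * a)%R = l.-1 * \sum_(i < f) Fp_nat (l%:R ^+ i * a)%R)%N.
Proof.
have shift : (\sum_(i < f) Fp_nat (l%:R ^+ i.+1 * a)%R = \sum_(i < f) Fp_nat (l%:R ^+ i * a)%R)%N.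
  case: (f) f_prim => [|f'] fp; first by rewrite !big_ord0.
  rewrite big_ord_recr [RHS]big_ord_recl /= (prim_expr_order fp) addnC.
  by rewrite expr0; congr (_ + _)%N; apply: eq_bigr.
apply: (@addIn (\sum_(i < f) Fp_nat (l%:R ^+ i.+1 * a)%R)).
rewrite [in RHS]shift -mulSnr prednK // !big_distrr -big_split /=.
by apply: eq_bigr => i _; rewrite ldigitP mulrA -exprS.
Qed.

Let omega_prim : q1.-primitive_root (omega l eps).
Proof. by have := dvdn_prim_root epsP (dvdn_mull l (dvdnn q1)); rewrite mulnK. Qed.

Let zeta_prim : l.-primitive_root (zeta E eps).
Proof. by have := dvdn_prim_root epsP (dvdn_mulr q1 (dvdnn l)); rewrite mulKn. Qed.

(** * The quadratic Gauss sum, its period eta and the splitting of l *)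

Definition zetap := omega l eps ^+ M.

Lemma zetap_prim : p.-primitive_root zetap.
Proof. exact: (dvdn_prim_root omega_prim p_dvd_q1). Qed.

Definition epow (a : 'F_p) := zetap ^+ Fp_nat a.

Lemma epow_nat n : zetap ^+ n = epow n%:R.
Proof. by rewrite /epow Fp_nat_natr // (prim_expr_mod zetap_prim). Qed.

Lemma epowD a b : epow (a + b) = epow a * epow b.
Proof. by rewrite -exprD epow_nat natrD !Fp_natK. Qed.

Lemma epow0 : epow 0 = 1. Proof. exact: expr0. Qed.

Lemma epow_nontrivial a : a != 0 -> epow a != 1.
Proof.
move=> na; rewrite -(prim_order_dvd zetap_prim) gtnNdvd ?Fp_nat_gt0 //.
exact: Fp_nat_lt.
Qed.

Lemma sum_epow c : \sum_(a : 'F_p) epow (a * c) = if c == 0 then p%:R else 0.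
Proof.
case: eqVneq => [-> | nc].
  by under eq_bigr => a _ do rewrite mulr0 epow0; rewrite sumr_const card_Fp.
have nz : epow c - 1 != 0 by rewrite subr_eq0 epow_nontrivial.
apply: (mulfI nz); rewrite mulr0 mulrBl mul1r; apply/eqP; rewrite subr_eq0; apply/eqP.
rewrite [in RHS](reindex_inj (addrI 1)) big_distrr.
by apply: eq_bigr => a _; rewrite mulrDl mul1r epowD.
Qed.

Definition tau := \sum_(a : 'F_p) (chi a)%:~R * epow a.

Lemma tau_twist c : \sum_(a : 'F_p) (chi a)%:~R * epow (a * c) = (chi c)%:~R * tau.
Proof.
have [-> | nc] := eqVneq c 0.
  rewrite chi0 mul0r; under eq_bigr => a _ do rewrite mulr0 epow0 mulr1.
  by rewrite -rmorph_sum sum_chi.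
rewrite /tau [in RHS](reindex_inj (mulIf nc)) big_distrr /=; apply: eq_bigr => a _.
by rewrite mulrA -intrM chiM // mulrCA chi_sqr // mulr1.
Qed.

(** [tau_twist] absorbs chi(b) into tau and turns tau^2 into a double sum of chi(a) [epow] ((a + 1)
    b). The sum over b vanishes unless a = -1, which leaves p chi(-1). *)
Lemma tau_sqr : tau ^+ 2 = - p%:R.
Proof.
rewrite expr2 {2}/tau big_distrr /=.
under eq_bigr => b _ do rewrite mulrA (mulrC tau) -tau_twist big_distrl /=.
rewrite exchange_big /=.
under eq_bigr => a _ do under eq_bigr => b _ do
  rewrite -mulrA -epowD -{2}(mul1r b) -mulrDl (mulrC _ b).
under eq_bigr => a _ do rewrite -big_distrr /= sum_epow.
rewrite (bigD1 (-1)) //= addNr eqxx chiN1 // mulN1r big1 ?addr0 // => a na.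
by rewrite addr_eq0 (negbTE na) mulr0.
Qed.

(** The Gaussian period (tau - 1) / 2. Unlike tau it generates, with 1, all integers of
    Q(sqrt(-p)). *)
Definition eta := \sum_(a : 'F_p | chi a == 1) epow a.

Lemma eta_nonresidues : \sum_(a : 'F_p | chi a == -1) epow a = - 1 - eta.
Proof.
have := sum_epow 1; rewrite oner_eq0; under eq_bigr => a _ do rewrite mulr1.
rewrite (bigID (fun a => chi a == 1)) /= -/eta (bigD1 0) /= ?chi0 // epow0.
rewrite (eq_bigl (fun a => chi a == -1)) => [|a].
  by move/eqP; rewrite addrA addr_eq0 => /eqP h; rewrite -opprD (addrC 1) h opprK.
have [-> | na] := eqVneq a 0; first by rewrite chi0.
by have [-> | ->] := chi_cases na.
Qed.

Lemma tau_eta : tau = 2 * eta + 1.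
Proof.
rewrite /tau (bigID (fun a => chi a == 1)) /=.
rewrite (eq_bigr epow) => [|a /eqP ->]; last by rewrite mul1r.
rewrite -/eta (bigID (fun a => chi a == -1)) /= [X in _ + (_ + X)]big1 ?addr0.
  rewrite (eq_big (fun a => chi a == -1) (fun a => - epow a)) => [|a|a /andP[_ /eqP ->]].
  - by rewrite sumrN eta_nonresidues; ring.
  - by rewrite andbC; case: eqP => // ->.
  - by rewrite mulN1r.
move=> a /andP[h1 h2]; have [-> | /chi_cases[] h] := eqVneq a 0; first by rewrite chi0 mul0r.
  by rewrite h in h1.
by rewrite h in h2.
Qed.

Let cp := (p.+1 %/ 4)%N.
Let c4 : (4 * cp = p.+1)%N. Proof. exact: quarter_succ. Qed.

Lemma eta_sqr : eta ^+ 2 + eta + cp%:R = 0.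
Proof.
have n4 : (4%:R : algC) != 0 by rewrite pnatr_eq0.
apply: (mulfI n4); rewrite mulr0 mulrDr -natrM c4 -[X in _ + X]natr1.
have := tau_sqr; rewrite tau_eta => h.
have -> : p%:R = - (2 * eta + 1) ^+ 2 by rewrite h opprK.
ring.
Qed.

Let zb := (x0 ^+ l) ^+ M.

Lemma reduces_epow a : red (epow a) (zb ^+ Fp_nat a).
Proof. by do 3!apply: reducesX; apply: reduces_eps. Qed.

Let eta_bar := \sum_(a : 'F_p | chi a == 1) zb ^+ Fp_nat a.

Lemma reduces_eta : red eta eta_bar.
Proof. by apply: reduces_sum => a _; apply: reduces_epow. Qed.

Lemma p_neq0E : p%:R != 0 :> E.
Proof.
rewrite -(dvdn_pcharf lE) dvdn_prime2 //; apply: contraNneq l_neq0 => ->.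
by rewrite pcharf0.
Qed.

Lemma eta_bar_sqr : eta_bar ^+ 2 + eta_bar + cp%:R = 0.
Proof.
have h : red (eta ^+ 2 + eta + cp%:R) (eta_bar ^+ 2 + eta_bar + cp%:R).
  apply: reducesD (reduces_nat _ _ _); apply: reducesD reduces_eta.
  by apply: reducesX; apply: reduces_eta.
by rewrite eta_sqr in h; apply: (reduces_fun epsP x0P h); apply: reduces0.
Qed.

Lemma eta_bar_disc : (2 * eta_bar + 1) ^+ 2 = - p%:R.
Proof.
have -> : (2 * eta_bar + 1) ^+ 2 = 4 * (eta_bar ^+ 2 + eta_bar + cp%:R) - (4 * cp)%N%:R + 1.
  by rewrite natrM; ring.
by rewrite eta_bar_sqr c4 -natr1; ring.
Qed.

(** A root modulo l puts [eta_bar] in the prime field, so Frobenius fixes it. If chi(l) = -1,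
    Frobenius would send it to the conjugate -1 - [eta_bar]; the two roots would coincide and the
    discriminant -p would vanish in E, although l != p. *)
Lemma split_chi (b : int) : (l%:Z %| b ^+ 2 - b + cp%:Z)%Z -> chi (l%:R : 'F_p) = 1.
Proof.
move=> /dvdzP[k Dk]; have hb : b%:~R ^+ 2 - b%:~R + cp%:R = 0 :> E.
  have := congr1 (intr : int -> E) Dk.
  by rewrite !rmorphD rmorphN rmorphXn rmorphM /= -!pmulrn (pcharf0 lE) mulr0.
have rl : eta_bar ^+ l = eta_bar.
  have : (eta_bar + b%:~R) * (eta_bar - b%:~R + 1) = 0.
    have -> : (eta_bar + b%:~R) * (eta_bar - b%:~R + 1)
      = (eta_bar ^+ 2 + eta_bar + cp%:R) - (b%:~R ^+ 2 - b%:~R + cp%:R) by ring.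
    by rewrite eta_bar_sqr hb subr0.
  move/eqP; rewrite mulf_eq0 => /orP[]; rewrite -?addrA addr_eq0 => /eqP ->.
    by rewrite -(pFrobenius_autE lE) rmorphN rmorph_int.
  by rewrite -(pFrobenius_autE lE) rmorphN rmorphD rmorphN rmorph_int rmorph1.
have [// | chil] := chi_cases l_neq0.
have h : red (\sum_(a : 'F_p | chi a == 1) epow (l%:R * a)) (eta_bar ^+ l).
  rewrite -(pFrobenius_autE lE) rmorph_sum /=; apply: reduces_sum => a _.
  rewrite pFrobenius_autE -{1}(Fp_natK a) -natrM -epow_nat mulnC exprM.
  by apply: reducesX; apply: reduces_epow.
have Dsum : \sum_(a : 'F_p | chi a == 1) epow (l%:R * a) = -1 - eta.
  rewrite -eta_nonresidues [RHS](reindex_inj (mulfI l_neq0)).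
  by apply: eq_bigl => a; rewrite chiM // chil mulN1r eqr_opp.
have hbar : eta_bar ^+ l = -1 - eta_bar.
  apply: (reduces_fun epsP x0P h); rewrite Dsum.
  apply: reducesB reduces_eta; apply: reducesN; exact: reduces1.
have := eta_bar_disc; have -> : 2 * eta_bar + 1 = 0.
  have -> : 2 * eta_bar + 1 = eta_bar - (-1 - eta_bar) by ring.
  by rewrite -hbar rl subrr.
by rewrite expr0n /= => /eqP; rewrite eq_sym oppr_eq0 (negbTE p_neq0E).
Qed.

(** * The product of Gauss sums over squares modulo powers of l *)

Hypothesis chi_l : chi (l%:R : 'F_p) = 1.

Variable g : 'F_p.
Hypothesis g_prim : p.-1.-primitive_root g.

Let m := (p.-1)./2.

Lemma f_dvd_half : (f %| m)%N.
Proof. by rewrite (prim_order_dvd f_prim) -chiP // ?l_neq0 // chi_l. Qed.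

Let H := (m %/ f)%N.
Let Hf : (H * f = m)%N. Proof. exact: divnK f_dvd_half. Qed.
Let g0 : g != 0.
Proof. by rewrite (prim_root_eq0 g_prim) gtn_eqF ?(prim_order_gt0 g_prim). Qed.

Let chig : chi g = -1. Proof. exact: chi_prim_root. Qed.

Let chig2 i : chi (g ^+ (2 * i)) = 1.
Proof. by rewrite chiX // chig exprM sqrrN !expr1n. Qed.

Definition res_pt (ji : 'I_H * 'I_f) : 'F_p := l%:R ^+ ji.2 * g ^+ (2 * ji.1).

(** The f-th power kills the power of l and leaves g^(2 f j), which determines j < H since 2 f H = p
    - 1. *)
Lemma res_pt_inj : injective res_pt.
Proof.
have lf n : (l%:R ^+ n : 'F_p) ^+ f = 1 by rewrite exprAC (prim_expr_order f_prim) expr1n.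
move=> [j i] [j' i'] e.
have ejj : j = j'.
  have := congr1 (fun x => x ^+ f) e; rewrite /res_pt /= !exprMn !lf !mul1r -!exprM => /eqP.
  rewrite (eq_prim_root_expr g_prim) !(mulnC 2) -!mulnA !(mulnC 2) !mulnA.
  have -> : p.-1 = (H * f * 2)%N by rewrite Hf double_half_pred.
  rewrite -!muln_modl eqn_pmul2r // eqn_pmul2r // !modn_small // => /eqP h.
  exact: val_inj.
congr (_, _) => //; apply: val_inj => /=; move: e; rewrite ejj /res_pt /= => /mulIf.
rewrite expf_neq0 // => /(_ isT)/eqP.
by rewrite (eq_prim_root_expr f_prim) !modn_small // => /eqP.
Qed.

Lemma chi_lX i : chi (l%:R ^+ i : 'F_p) = 1.
Proof. by rewrite chiX // chi_l expr1n. Qed.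

(** There are H f = m distinct points, while X^m - 1 has at most m roots. *)
Lemma res_pt_image : [set res_pt ji | ji in [set: 'I_H * 'I_f]]%SET = [set x | chi x == 1]%SET.
Proof.
apply/eqP; rewrite eqEcard; apply/andP; split.
  apply/fintype.subsetP => _ /imsetP[ji _ ->]; rewrite inE chiM // chi_lX chig2 //.
rewrite card_imset; last exact: res_pt_inj.
rewrite cardsT card_prod !card_ord Hf fintype.cardE.
have hm : (0 < m)%N by have := odd_half_pred p_pr p3; rewrite -/m; case: (m).
apply: max_unity_roots => //; last exact: enum_uniq.
apply/allP => x; rewrite mem_enum inE unity_rootE => h.
by rewrite -chiP //; apply: contraTN h => /eqP ->; rewrite chi0.
Qed.

Lemma sum_residues (F : 'F_p -> nat) :
  (\sum_(x : 'F_p | chi x == 1%R) F x = \sum_(j < H) \sum_(i < f) F (l%:R ^+ i * g ^+ (2 * j))%R)%N.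
Proof.
rewrite pair_big; transitivity (\sum_(ji in [set: 'I_H * 'I_f]%SET) F (res_pt ji))%N.
  rewrite -(big_imset F (in2W res_pt_inj)) res_pt_image.
  by apply: eq_bigl => x; rewrite inE.
by apply: eq_bigl => ji; rewrite inE.
Qed.

(* The points g^(2 j), j < H, represent the squares modulo the powers of l. *)
Definition gauss_prod (c : 'F_p) := \prod_(j < H) gaussp (g ^+ (2 * j) * c).

Lemma sum_residues_mul (x : 'F_p) :
  (\sum_(j < H) \sum_(i < f) Fp_nat (l%:R ^+ i * (g ^+ (2 * j) * x))%R
   = \sum_(y : 'F_p | chi y == 1%R) Fp_nat (y * x)%R)%N.
Proof.
rewrite (sum_residues (fun y => Fp_nat (y * x))).
by apply: eq_bigr => j _; apply: eq_bigr => i _; rewrite mulrA.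
Qed.

(** The disjunction treats the product and its conjugate together. In the second case x -> - x
    exchanges residues and nonresidues, as chi(-1) = -1. *)
Lemma sum_coset_val (c : 'F_p) (b : nat) :
  c = 1 /\ b = res_quot p \/ c = -1 /\ b = nres_quot p ->
  (\sum_(j < H) \sum_(i < f) Fp_nat (l%:R ^+ i * (g ^+ (2 * j) * c))%R = p * b)%N.
Proof.
rewrite sum_residues_mul => -[] [-> ->].
  rewrite /res_quot mulnC divnK ?dvd_res_sum //.
  by apply: eq_bigr => x _; rewrite mulr1.
rewrite /nres_quot mulnC divnK ?dvd_nres_sum //.
rewrite /nres_sum [RHS](reindex_inj (@oppr_inj _)).
by apply: eq_big => [x | x _]; rewrite ?mulrN1 // chiN // eqr_opp.
Qed.

(** The upper bound b on the valuation. The digits of all the exponents add up to (l - 1) b, so the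
    product divides [G 1] ^+ ((l - 1) b), and [gauss1_pow] turns this power into l^b up to units at
    the place. *)
Lemma gauss_prod_dvd c b :
  c = 1 /\ b = res_quot p \/ c = -1 /\ b = nres_quot p ->
  exists J y w yw, [/\ red J y, red w yw, yw != 0 & J * gauss_prod c = l%:R ^+ b * w].
Proof.
move=> hc; have hS := sum_coset_val hc.
have [J [y [rJ DJ]]] : exists J y, red J y /\ G 1 ^+ (l.-1 * b) = J * gauss_prod c.
  have -> : (l.-1 * b = \sum_(j < H) \sum_(i < f) ldigit (l%:R ^+ i * (g ^+ (2 * j) * c))%R)%N.
    apply/eqP; rewrite -(eqn_pmul2l p0) mulnCA -hS !big_distrr /=; apply/eqP.
    by apply: eq_bigr => j _; rewrite ldigit_sum.
  rewrite /gauss_prod; elim: (index_enum _) => [|j r [J [y [rJ DJ]]]].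
    by exists 1, 1; rewrite !big_nil expr0 mulr1; split=> //; apply: reduces1.
  have [J' [y' [rJ' DJ']]] := gauss1_dvd_gaussp (g ^+ (2 * j) * c).
  exists (J' * J), (y' * y); split; first exact: reducesM.
  by rewrite !big_cons exprD DJ DJ' mulrACA.
have [u [yu [v [yv [ru yu0 rv yv0 Duv]]]]] := gauss1_pow lE cardE f0 q1_gt1 epsP x0_prim.
exists (v ^+ b * J), (yv ^+ b * y), (u ^+ b), (yu ^+ b); split.
- by apply: reducesM => //; apply: reducesX.
- exact: reducesX.
- exact: expf_neq0.
- by rewrite -mulrA -DJ exprM mulrC -!exprMn Duv.
Qed.

(** Its square and its p-th power are both 1, and p is odd. *)
Lemma kappaN1_expM : kap (-1) ^+ M = 1.
Proof.
have N10 : -1 != 0 :> E by rewrite oppr_eq0 oner_eq0.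
have t2 : (kap (-1) ^+ M) ^+ 2 = 1.
  by rewrite exprAC -kapX // sqrrN expr1n (kappa1 lE cardE f0 q1_gt1 epsP x0_prim) expr1n.
have tp : (kap (-1) ^+ M) ^+ p = 1 by rewrite -exprM Mp (kappa_order x0 q1_gt1 epsP).
by move: tp; rewrite (odd_eq_half p_pr p3) exprD exprM t2 expr1n mul1r expr1.
Qed.

Lemma gaussp_norm (a : 'F_p) : a != 0 -> gaussp a * gaussp (- a) = l%:R ^+ f.
Proof.
move=> na; have na' : - a != 0 by rewrite oppr_eq0.
have M0 : (0 < M)%N by move: q1_gt0; rewrite -Mp; case: (M).
rewrite /gaussp (gauss_norm lE cardE f0 q1_gt1 epsP x0_prim).
- by rewrite mulnC exprM kappaN1_expM expr1n mul1r cardE natrX.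
- rewrite gtnNdvd ?muln_gt0 ?Fp_nat_gt0 // -/q1 -Mp mulnC ltn_pmul2l //.
  exact: Fp_nat_lt.
- by rewrite -mulnDl Fp_nat_opp // mulnC Mp dvdnn.
Qed.

Lemma gauss_prod_norm : gauss_prod 1 * gauss_prod (-1) = l%:R ^+ m.
Proof.
rewrite /gauss_prod -big_split /= (eq_bigr (fun=> l%:R ^+ f)) => [|j _].
  by rewrite prodr_const card_ord -exprM mulnC Hf.
by rewrite mulr1 mulrN1 gaussp_norm // expf_neq0.
Qed.

(** The index j is shifted by one. The factor that wraps around involves g^(2 H), whose f-th power
    is 1; it is thus a power of l, which [gaussp] does not see. *)
Lemma gauss_prod_g2 x : gauss_prod (g ^+ 2 * x) = gauss_prod x.
Proof.
have wrap : gaussp (g ^+ (2 * H) * x) = gaussp x.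
  have /(prim_rootP f_prim)[i ->] : (g ^+ (2 * H)) ^+ f = 1.
    by rewrite -exprM -mulnA Hf mulnC double_half_pred // (prim_expr_order g_prim).
  exact: gaussp_lX.
transitivity (\prod_(j < H) gaussp (g ^+ (2 * j.+1) * x)).
  by apply: eq_bigr => j _; rewrite mulrA -exprD mulnS addnC.
rewrite /gauss_prod; case: (H) wrap => [|H'] wrap; first by rewrite !big_ord0.
rewrite big_ord_recr [RHS]big_ord_recl /= wrap mulrC muln0 mul1r.
by congr (_ * _); apply: eq_bigr.
Qed.

Lemma gauss_prod_res y x : chi y = 1 -> gauss_prod (y * x) = gauss_prod x.
Proof.
move=> chiy; have ny : y != 0 by apply: contra_eqN chiy => /eqP ->; rewrite chi0.
have [k Dy] := prim_rootP g_prim (Fp_expr p_pr ny).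
move: chiy; rewrite Dy chiX // chig -signr_odd.
case: (boolP (odd k)) => // ok _; rewrite -(odd_double_half k) (negbTE ok) add0n -mul2n exprM.
elim: (k./2) => [|n IHn]; first by rewrite mul1r.
by rewrite exprS -mulrA gauss_prod_g2.
Qed.

Lemma residue_val_sum_dvd (x : 'F_p) :
  (p %| \sum_(y : 'F_p | chi y == 1%R) Fp_nat (y * x)%R)%N.
Proof.
have h : \sum_(y : 'F_p | chi y == 1) y = 0.
  apply/eqP; have := dvd_res_sum p_pr p3 p_neq3; rewrite (dvdn_pcharf pF) natr_sum.
  by under eq_bigr => y _ do rewrite Fp_natK.
rewrite (dvdn_pcharf pF) natr_sum; under eq_bigr => y _ do rewrite Fp_natK.
by rewrite -big_distrl /= h mul0r.
Qed.

(** This is the factor an automorphism introduces by moving zeta. Its p-th power is 1. Its f-th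
    power spreads the exponents over all squares, whose sum is divisible by p, so it is 1 too; since
    f <= (p - 1) / 2 < p, the order is 1. *)
Lemma kappa_coset_prod (e : E) (x : 'F_p) : e != 0 -> e ^+ l = e ->
  \prod_(j < H) kap e ^+ (Fp_nat (g ^+ (2 * j) * x) * M) = 1.
Proof.
move=> ne el; have kl : kap e ^+ l = kap e by rewrite -kapX // el.
have kM : (kap e ^+ M) ^+ p = 1 by rewrite -exprM Mp (kappa_order x0 q1_gt1 epsP).
pose K := kap e ^+ M.
have Kn n : K ^+ n = K ^+ Fp_nat (n%:R : 'F_p) by rewrite Fp_nat_natr // expr_mod.
have Kl (a : 'F_p) : K ^+ Fp_nat (l%:R * a) = K ^+ Fp_nat a.
  rewrite -{1}(Fp_natK a) -natrM -Kn exprM; congr (_ ^+ _).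
  by rewrite /K exprAC kl.
have KlX i (a : 'F_p) : K ^+ Fp_nat (l%:R ^+ i * a) = K ^+ Fp_nat a.
  by elim: i => [|i IHi]; rewrite ?mul1r // exprS -mulrA Kl.
under eq_bigr => j _ do rewrite mulnC exprM -/K.
set Q := \prod_(_ < _) _.
have Qf : Q ^+ f = 1.
  rewrite /Q -prodrXl.
  transitivity (\prod_(j < H) \prod_(i < f) K ^+ Fp_nat (l%:R ^+ i * (g ^+ (2 * j) * x))).
    apply: eq_bigr => j _; under [RHS]eq_bigr => i _ do rewrite KlX.
    by rewrite prodr_const card_ord.
  under eq_bigr => j _ do rewrite prodrXr.
  rewrite prodrXr sum_residues_mul; have /dvdnP[t ->] := residue_val_sum_dvd x.
  by rewrite mulnC exprM kM expr1n.
have Qp : Q ^+ p = 1.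
  by rewrite /Q -prodrXl big1 // => j _; rewrite exprAC kM expr1n.
have [n np nf] := prim_order_exists f0 Qf.
have := Qp; move/eqP; rewrite -(prim_order_dvd np) => nP.
have m0 : (0 < m)%N by have := odd_half_pred p_pr p3; rewrite -/m; case: (m).
have n1 : n = 1%N.
  apply/eqP; apply: contraT => n1; have := prime_nt_dvdP p_pr n1 nP => Dn.
  have := dvdn_leq m0 (dvdn_trans nf f_dvd_half); rewrite Dn => pm.
  by have := half_pred_lt p_pr p3; rewrite ltnNge pm.
by have := prim_expr_order np; rewrite n1 expr1.
Qed.

(** * Galois action on the Gauss sums and descent to Q(sqrt(-p)) *)

Section Automorphism.

Variables (u : {rmorphism algC -> algC}) (k n : nat).
Hypotheses (uomega : u (omega l eps) = omega l eps ^+ k).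
Hypotheses (uzeta : u (zeta E eps) = zeta E eps ^+ n) (co_n : coprime n l).

Let e : E := n%:R.

Let e0 : e != 0.
Proof. by rewrite /e -(dvdn_pcharf lE) -prime_coprime // coprime_sym. Qed.

Lemma aut_kappa x : u (kap x) = kap x ^+ k.
Proof. by rewrite /kappa rmorphXn uomega exprAC. Qed.

Lemma aut_psi x : u (psi l f eps x) = psi l f eps (e * x).
Proof.
rewrite {1}/psi rmorphXn uzeta -exprM mulnC exprM -/(psi l f eps x) /e mulr_natl.
elim: (n) => [|i IHi]; first by rewrite expr0 mulr0n (psi0 lE cardE f0 epsP).
by rewrite exprS mulrS (psiD lE cardE f0 epsP) IHi.
Qed.

Lemma aut_gauss i : u (G i) = kap e^-1 ^+ (k * i) * G (k * i).
Proof.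
rewrite -(gauss_twist lE cardE f0 q1_gt1 epsP x0_prim _ e0) /gauss rmorph_sum.
by apply: eq_bigr => x _; rewrite rmorphM rmorphXn aut_psi aut_kappa -exprM.
Qed.

Lemma aut_gaussp a :
  u (gaussp a) = kap e^-1 ^+ (Fp_nat (k%:R * a) * M) * gaussp (k%:R * a).
Proof.
rewrite {1}/gaussp aut_gauss mulnA gaussp_nat natrM Fp_natK; congr (_ * _).
rewrite !(mulnC _ M) exprM [RHS]exprM.
have KM : (kap e^-1 ^+ M) ^+ p = 1 by rewrite -exprM Mp (kappa_order x0 q1_gt1 epsP).
by rewrite -[LHS](expr_mod _ KM) -Fp_nat_natr // natrM Fp_natK.
Qed.

Lemma aut_gauss_prod c : k%:R * c != 0 -> u (gauss_prod c) = gauss_prod (k%:R * c).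
Proof.
move=> kc; rewrite rmorph_prod /=; under eq_bigr => j _ do rewrite aut_gaussp mulrCA.
rewrite big_split /= kappa_coset_prod ?mul1r // ?invr_eq0 // /e.
by rewrite exprVn -(pFrobenius_autE lE) rmorph_nat.
Qed.

Lemma aut_tau : u tau = (chi (k%:R : 'F_p))%:~R * tau.
Proof.
rewrite -tau_twist /tau rmorph_sum; apply: eq_bigr => a _ /=.
rewrite rmorphM rmorph_int; congr (_ * _); rewrite {1}/epow rmorphXn.
have -> : u zetap = zetap ^+ k by rewrite /zetap rmorphXn uomega exprAC.
by rewrite -exprM epow_nat natrM Fp_natK mulrC.
Qed.

End Automorphism.

Lemma aut_exponents (u : {rmorphism algC -> algC}) : exists k n,
  [/\ u (omega l eps) = omega l eps ^+ k, u (zeta E eps) = zeta E eps ^+ n,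
     coprime n l & (k%:R : 'F_p) != 0].
Proof.
have [k cok Dk] := aut_prim_rootP u omega_prim.
have [n con Dn] := aut_prim_rootP u zeta_prim.
exists k, n; split=> //; rewrite -(dvdn_pcharf pF) -prime_coprime // coprime_sym.
exact: coprime_dvdr p_dvd_q1 cok.
Qed.

(** The sign chi(k) governs both the exchange of the two products and the sign of tau; hence the
    difference of the products times tau is invariant. *)
Lemma aut_gauss_prods (u : {rmorphism algC -> algC}) :
  [/\ u (gauss_prod 1) = gauss_prod 1, u (gauss_prod (-1)) = gauss_prod (-1) & u tau = tau]
  \/ [/\ u (gauss_prod 1) = gauss_prod (-1), u (gauss_prod (-1)) = gauss_prod 1 & u tau = - tau].
Proof.
have [k [n [uo uz con k0]]] := aut_exponents u.
rewrite !(aut_gauss_prod uo uz con) ?mulr1 ?mulrN1 ?oppr_eq0 // (aut_tau uo).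
have [h | h] := chi_cases k0; [left | right].
  have P1 : gauss_prod k%:R = gauss_prod 1 by rewrite -[k%:R]mulr1 gauss_prod_res.
  have PN : gauss_prod (- k%:R) = gauss_prod (-1) by rewrite -mulrN1 gauss_prod_res.
  by rewrite P1 PN h mul1r.
have hN : chi (- k%:R : 'F_p) = 1 by rewrite chiN // h opprK.
have P1 : gauss_prod (- k%:R) = gauss_prod 1 by rewrite -[- k%:R]mulr1 gauss_prod_res.
have PN : gauss_prod k%:R = gauss_prod (-1).
  have -> : k%:R = - k%:R * -1 :> 'F_p by rewrite mulrN1 opprK.
  by rewrite gauss_prod_res.
by rewrite P1 PN h mulN1r.
Qed.

Lemma reduces_gauss_prod c : exists y, red (gauss_prod c) y.
Proof.
have rG i : exists y, red (G i) y.
  apply: reduces_ex_sum => x nx; eexists; apply: reducesM.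
    by apply: reducesX; apply: (reduces_kappa eps lE cardE f0 q1_gt1 x0_prim).
  exact: (reduces_psi l f eps x0_prim).
rewrite /gauss_prod; elim: (index_enum _) => [|j r [y hy]].
  by exists 1; rewrite big_nil; apply: reduces1.
have [y' hy'] := rG (Fp_nat (g ^+ (2 * j) * c)%R * M)%N.
by exists (y' * y); rewrite big_cons; apply: reducesM.
Qed.

Lemma reduces_Aint z y : red z y -> z \in Aint.
Proof.
move=> [F [-> _]]; rewrite horner_coef rpred_sum // => i _.
rewrite rpredM ?rpredX ?(Aint_prim_root epsP) // coef_map; exact: Aint_int.
Qed.

Lemma fixed_int z y : red z y -> (forall u : {rmorphism algC -> algC}, u z = z) ->
  exists a : int, z = a%:~R.
Proof.
move=> rz; have Az := reduces_Aint rz; case: rz Az => F [-> _] Az fixz; apply/intrP.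
apply: Cint_rat_Aint => //; apply: fixed_Crat fixz; last exact: (prim_expr_order epsP).
exact: prim_order_gt0 epsP.
Qed.

(** Galois invariance makes X, the sum of the two products, and Y, their difference times tau,
    rational integers. The norm relation forces p | Y, so the difference is an integer multiple of
    tau, and a parity argument removes the denominator 2. *)
Lemma gauss_prod_int : exists A B : int,
  [/\ gauss_prod 1 = A%:~R + B%:~R * eta, gauss_prod (-1) = A%:~R + B%:~R * (-1 - eta)
    & A ^+ 2 - A * B + cp%:Z * B ^+ 2 = (l ^ m)%N%:Z].
Proof.
have [y1 r1] := reduces_gauss_prod 1.
have [y2 r2] := reduces_gauss_prod (-1).
have [yt rt] : exists y, red tau y.
  rewrite tau_eta; eexists; apply: reducesD; last exact: reduces1.
  by apply: reducesM reduces_eta; apply: (reduces_nat _ _ 2).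
have [X DX] : exists a : int, gauss_prod 1 + gauss_prod (-1) = a%:~R.
  apply: (fixed_int (reducesD r1 r2)) => u; rewrite rmorphD.
  by have [[-> -> _] | [-> -> _]] := aut_gauss_prods u; rewrite // addrC.
have [Y DY] : exists a : int, (gauss_prod 1 - gauss_prod (-1)) * tau = a%:~R.
  apply: (fixed_int (reducesM (reducesB r1 r2) rt)) => u; rewrite rmorphM rmorphB.
  have [[-> -> ->] | [-> -> ->]] := aut_gauss_prods u; rewrite //; ring.
have norm := gauss_prod_norm.
(* The difference of the squares of the sum and the difference is four times the product; tau^2 = -p
   accounts for the factor p. *)
have E1 : p%:Z * X ^+ 2 + Y ^+ 2 = 4 * p%:Z * (l ^ m)%N%:Z.
  apply: (@intr_inj algC); rewrite !(rmorphD, rmorphM, rmorphXn) /= -DX -DY exprMn tau_sqr.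
  rewrite -!pmulrn -norm; ring.
have [Z DZ] : exists Z : int, Y = - p%:Z * Z.
  have : (p%:Z %| Y ^+ 2)%Z.
    by apply/dvdzP; exists (4 * (l ^ m)%N%:Z - X ^+ 2); apply: norm_rel_dvd E1.
  rewrite dvdzE abszX /= Euclid_dvdX // andbT => h.
  have /dvdzP[Z ->] : (p%:Z %| Y)%Z by rewrite dvdzE.
  by exists (- Z); rewrite mulrNN mulrC.
have p0' : (p%:R : algC) != 0 by rewrite pnatr_eq0 -lt0n.
have tau0 : tau != 0 by rewrite -sqrf_eq0 tau_sqr oppr_eq0.
have Ddiff : gauss_prod 1 - gauss_prod (-1) = Z%:~R * tau.
  apply: (mulIf tau0); rewrite DY -mulrA -expr2 tau_sqr DZ rmorphM rmorphN /= -pmulrn; ring.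
have E2 : X ^+ 2 + p%:Z * Z ^+ 2 = 4 * (l ^ m)%N%:Z.
  have pz : p%:Z != 0 by rewrite eqz_nat -lt0n.
  by apply: norm_rel_div pz _; rewrite -DZ.
have c4Z : 4 * cp%:Z = p%:Z + 1 by rewrite -[4]/(4%N%:Z) -PoszM c4 -addn1.
have [A [DA normA]] := half_sum_int c4Z E2.
have n2 : (2 : algC) != 0 by rewrite pnatr_eq0.
have D1 : gauss_prod 1 = A%:~R + Z%:~R * eta.
  apply: (mulfI n2).
  transitivity (X%:~R + Z%:~R * tau); first by rewrite -DX -Ddiff; ring.
  have -> : X%:~R = 2 * A%:~R - Z%:~R :> algC.
    have := congr1 (intr : int -> algC) DA; rewrite rmorphD rmorphM /= => <-; ring.
  rewrite tau_eta; ring.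
have D2 : gauss_prod (-1) = A%:~R + Z%:~R * (-1 - eta).
  have -> : gauss_prod (-1) = gauss_prod 1 - Z%:~R * tau by rewrite -Ddiff; ring.
  by rewrite D1 tau_eta; ring.
by exists A, Z; split.
Qed.

(** Otherwise w would be J times a positive power of l, and its reduction would be 0. *)
Lemma reduces_lval J y w yw a b : red J y -> red w yw -> yw != 0 ->
  J * l%:R ^+ a = l%:R ^+ b * w -> (a <= b)%N.
Proof.
move=> rJ rw yw0 h; rewrite leqNgt; apply: contra yw0 => ba.
have ln0 : l%:R ^+ b != 0 :> algC by rewrite expf_neq0 // pnatr_eq0 -lt0n.
have Dw : w = J * l%:R ^+ (a - b).
  by apply: (mulfI ln0); rewrite -h mulrCA -exprD subnKC // ltnW.
have rw' : red w (y * l%:R ^+ (a - b)).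
  by rewrite Dw; apply: reducesM => //; apply: reducesX; apply: reduces_nat.
rewrite (reduces_fun epsP x0P rw rw') (pcharf0 lE) expr0n subn_eq0 leqNgt ba.
by rewrite mulr0.
Qed.

Lemma stickelberger_norm_form : exists A B : int,
  ~~ ((l%:Z %| A)%Z && (l%:Z %| B)%Z)
  /\ A ^+ 2 - A * B + cp%:Z * B ^+ 2 = (l ^ `|bernoulli p|)%N%:Z.
Proof.
have [A [B [DP DN norm]]] := gauss_prod_int.
have [k [A' [B' [DA DB nd km norm']]]] := norm_form_content l_pr norm.
exists A', B'; split=> //; rewrite norm'; congr (Posz (l ^ _)).
set n := (m - 2 * k)%N in norm' *.
have Dm : (n + 2 * k = res_quot p + nres_quot p)%N by rewrite quot_sum // /n subnK.
pose Q1 := A'%:~R + B'%:~R * eta; pose Q2 := A'%:~R + B'%:~R * (-1 - eta) : algC.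
have DP' : gauss_prod 1 = Q1 * l%:R ^+ k.
  by rewrite DP /Q1 DA DB !rmorphM /= -!pmulrn natrX; ring.
have DN' : gauss_prod (-1) = Q2 * l%:R ^+ k.
  by rewrite DN /Q2 DA DB !rmorphM /= -!pmulrn natrX; ring.
have Q12 : Q1 * Q2 = l%:R ^+ n.
  transitivity ((A' ^+ 2 - A' * B' + cp%:Z * B' ^+ 2)%:~R : algC).
    rewrite !(rmorphD, rmorphM, rmorphXn, rmorphN) /= -pmulrn /Q1 /Q2.
    have -> : cp%:R = - (eta ^+ 2 + eta) :> algC.
      by apply/eqP; rewrite -addr_eq0 addrC eta_sqr.
    ring.
  by rewrite norm' -pmulrn natrX.
pose r1 := A'%:~R + B'%:~R * eta_bar; pose r2 := A'%:~R + B'%:~R * (-1 - eta_bar).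
have rQ1 : red Q1 r1.
  apply: reducesD; first exact: reduces_int.
  by apply: reducesM reduces_eta; apply: reduces_int.
have rQ2 : red Q2 r2.
  apply: reducesD; first exact: reduces_int.
  apply: reducesM; first exact: reduces_int.
  by apply: reducesB reduces_eta; apply: reducesN; apply: reduces1.
have [J1 [y1 [w1 [z1 [rJ1 rw1 z10 D1]]]]] := gauss_prod_dvd (or_introl (conj erefl erefl)).
have [J2 [y2 [w2 [z2 [rJ2 rw2 z20 D2]]]]] := gauss_prod_dvd (or_intror (conj erefl erefl)).
have k0 : (k <= res_quot p)%N.
  apply: (reduces_lval (reducesM rJ1 rQ1) rw1 z10); by rewrite -D1 DP' mulrA.
have k1 : (k <= nres_quot p)%N.
  apply: (reduces_lval (reducesM rJ2 rQ2) rw2 z20); by rewrite -D2 DN' mulrA.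
(* Whichever of Q1, Q2 has nonzero reduction is a unit at the place, so the other one carries all of
   Q1 Q2 = l^n. *)
have [r10 | r10] := eqVneq r1 0; last first.
  apply: (two_sided_valuation Dm k0).
  apply: (reduces_lval rJ2 (reducesM rw2 rQ1)); first by rewrite mulf_neq0.
  by rewrite mulrA -D2 DN' exprD -Q12; ring.
(* If both reductions vanished, so would their difference B' (2 [eta_bar] + 1), whose second factor
   squares to -p; l would then divide B' and A'. *)
have r20 : r2 != 0.
  apply: contra nd => /eqP r20.
  have dvd_int (z : int) : z%:~R = 0 :> E -> (l%:Z %| z)%Z.
    rewrite dvdzE (dvdn_pcharf lE) => /eqP; case: z => z /=; first by rewrite -pmulrn.
    by rewrite NegzE rmorphN oppr_eq0 /= -pmulrn.
  have B0 : B'%:~R = 0 :> E.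
    have : B'%:~R * (2 * eta_bar + 1) = 0.
      have -> : B'%:~R * (2 * eta_bar + 1) = r1 - r2 by rewrite /r1 /r2; ring.
      by rewrite r10 r20 subrr.
    move/eqP; rewrite mulf_eq0 => /orP[/eqP // | h].
    by have := eta_bar_disc; rewrite (eqP h) expr0n /= => /eqP; rewrite eq_sym oppr_eq0 (negbTE p_neq0E).
  rewrite !dvd_int //.
  by move: r10; rewrite /r1 B0 mul0r addr0.
rewrite /bernoulli -abszN opprB; apply: (two_sided_valuation _ k1); first by rewrite Dm addnC.
apply: (reduces_lval rJ1 (reducesM rw1 rQ2)); first by rewrite mulf_neq0.
by rewrite mulrA -D1 DP' exprD -Q12; ring.
Qed.

End Stickelberger.

Theorem prime_power_norm_form (p l : nat) (b : int) :
  prime p -> p = 3 %[mod 4] -> p != 3%N -> prime l -> l != p ->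
  (l%:Z %| b ^+ 2 - b + (p.+1 %/ 4)%:Z)%Z ->
  exists A B : int, ~~ ((l%:Z %| A)%Z && (l%:Z %| B)%Z)
    /\ A ^+ 2 - A * B + (p.+1 %/ 4)%:Z * B ^+ 2 = (l ^ `|bernoulli p|)%N%:Z.
Proof.
move=> p_pr p3 p_neq3 l_pr lp hb.
have ln0 : l%:R != 0 :> 'F_p by rewrite -(dvdn_pcharf (pchar_Fp p_pr)) dvdn_prime2 // eq_sym.
have p1 : (0 < p.-1)%N by have := prime_gt1 p_pr; case: (p) => // -[].
have [f f_prim _] := prim_order_exists p1 (Fp_expr p_pr ln0).
have f0 := prim_order_gt0 f_prim.
have [E lE cardE] := pPrimePowerField l_pr f0.
have [x0 x0_prim] := finField_prim_root E.
have co : coprime l #|E|.-1.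
  have Dq : (l ^ f)%N = #|E|.-1.+1 by rewrite -cardE (prednK (ltnW (finNzRing_gt1 E))).
  rewrite prime_coprime //; apply/negP; move: Dq; move: (#|E|.-1) => q Dq d.
  have : (l %| q.+1)%N by rewrite -Dq dvdn_exp.
  by rewrite -addn1 dvdn_addr // dvdn1 => /eqP l1; move: l_pr; rewrite l1.
have x0P := root_Cyclotomic_pchar lE co x0_prim.
have [eps epsP] : {z : algC | (l * #|E|.-1).-primitive_root z}.
  by apply: C_prim_root_exists; rewrite muln_gt0 prime_gt0 // (prim_order_gt0 x0_prim).
have [g g_prim] := finField_prim_root 'F_p; rewrite card_Fp // in g_prim.
have chi_l := split_chi p_pr p3 lE cardE f_prim epsP x0P x0_prim hb.
exact: (stickelberger_norm_form p_pr p3 p_neq3 lE cardE f_prim epsP x0P x0_prim chi_l g_prim).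
Qed.

(** * Products and classes of ideals *)

(** The inverse of x is x^(n-1), so an exponent for the monoid already makes it a group. An element
    of order h then has h dividing n. *)
Lemma cauchy_monoid (T : finType) (op : T -> T -> T) (e : T) (n h : nat) :
  associative op -> commutative op -> left_id e op ->
  (0 < n)%N -> (forall x, iter n (op x) e = e) ->
  prime h -> (h %| #|T|)%N -> (h %| n)%N.
Proof.
case: T op e => T cT op e opA opC op1 n0 opn h_pr hT.
pose inv x := iter n.-1 (op x) e.
have opV : left_inverse e inv op.
  by move=> x; rewrite opC /inv -[RHS](opn x) -[in RHS](prednK n0).
pose FT := Finite.Pack cT.
pose isG := Finite_isGroup.Build FT opA op1 opV.
pose gT : finGroupType := HB.pack FT isG.
have [x _ xh] : {x : gT | x \in [set: gT]%SET & #[x]%g = h}.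
  by apply: Cauchy => //; rewrite cardsT.
rewrite -xh order_dvdn; apply/eqP; rewrite -[RHS](opn x).
elim: (n) => [|k IHk]; first by rewrite expg0.
by rewrite expgS IHk.
Qed.

Section IdealMonoid.

Variable K : fieldExtType rat.
Local Open Scope classical_set_scope.

Notation O := (@ring_of_integers K).
Implicit Types (I J L : set K) (x y a b : K).

Lemma O_0 : O 0. Proof. exact: integral0. Qed.
Lemma O_1 : O 1. Proof. exact: integral1. Qed.
Lemma O_add x y : O x -> O y -> O (x + y). Proof. exact: integral_add. Qed.
Lemma O_opp x : O x -> O (- x). Proof. exact: integral_opp. Qed.
Lemma O_mul x y : O x -> O y -> O (x * y). Proof. exact: integral_mul. Qed.
Lemma O_int (m : int) : O m%:~R. Proof. exact: integral_id. Qed.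

Lemma O_exp x n : O x -> O (x ^+ n).
Proof. by move=> Ox; elim: n => [|n IHn]; [apply: O_1 | rewrite exprS; apply: O_mul]. Qed.

Lemma ideal_O : integral_ideal O.
Proof. by split=> //; [apply: O_0 | apply: O_add | apply: O_mul]. Qed.

Lemma nonzero_ideal_O : nonzero_ideal O.
Proof. by split; [apply: ideal_O | exists 1; [apply: O_1 | apply: oner_neq0]]. Qed.

Lemma ideal_opp I x : integral_ideal I -> I x -> I (- x).
Proof.
by case=> _ _ _ Im Ix; rewrite -mulN1r; apply: Im => //; apply: O_opp; apply: O_1.
Qed.

(** The smallest ideal containing the products, as an intersection; no finite sums have to be
    handled. *)
Definition prodI (I J : set K) : set K :=
  [set z | forall L, integral_ideal L -> (forall x y, I x -> J y -> L (x * y)) -> L z].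

Lemma prodI_mem I J x y : I x -> J y -> prodI I J (x * y).
Proof. by move=> Ix Jy L _; apply. Qed.

Lemma prodI_min I J L : integral_ideal L ->
  (forall x y, I x -> J y -> L (x * y)) -> prodI I J `<=` L.
Proof. by move=> iL h z; apply. Qed.

Lemma ideal_prodI I J : integral_ideal I -> integral_ideal J -> integral_ideal (prodI I J).
Proof.
move=> [IO _ _ _] [JO _ _ _]; split.
- by move=> z; apply; [apply: ideal_O | move=> x y /IO Ox /JO Oy; apply: O_mul].
- by move=> L [].
- by move=> x y hx hy L iL h; case: (iL) => _ _ LD _; apply: LD; [apply: hx | apply: hy].
- by move=> a x Oa hx L iL h; case: (iL) => _ _ _ LM; apply: LM => //; apply: hx.
Qed.

Lemma nonzero_prodI I J : nonzero_ideal I -> nonzero_ideal J -> nonzero_ideal (prodI I J).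
Proof.
move=> [iI [x Ix x0]] [iJ [y Jy y0]]; split; first exact: ideal_prodI.
by exists (x * y); [apply: prodI_mem | apply: mulf_neq0].
Qed.

Lemma prodIC I J : prodI I J = prodI J I.
Proof.
by apply/seteqP; split=> z hz L iL h; apply: hz => // x y Ix Jy; rewrite mulrC; apply: h.
Qed.

(** Replaces induction on finite sums: to show a z in L for all z of a product ideal, apply the
    minimality of the latter to this colon ideal. *)
Lemma ideal_colon (L : set K) (a : K) : O a -> integral_ideal L ->
  integral_ideal [set z | O z /\ L (a * z)].
Proof.
move=> Oa [LO L0 LD LM]; split=> /=.
- by move=> z [].
- by split; [apply: O_0 | rewrite mulr0].
- by move=> x y [Ox Lx] [Oy Ly]; split; [apply: O_add | rewrite mulrDr; apply: LD].
- by move=> b x Ob [Ox Lx]; split; [apply: O_mul | rewrite mulrCA; apply: LM].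
Qed.

Lemma prodI_assoc_sub I J L : integral_ideal I -> integral_ideal J -> integral_ideal L ->
  prodI I (prodI J L) `<=` prodI (prodI I J) L.
Proof.
move=> iI iJ iL; have iIJ := ideal_prodI iI iJ; have iT := ideal_prodI iIJ iL.
case: (iI) => IO _ _ _; case: (iJ) => JO _ _ _; case: (iL) => LO _ _ _.
apply: prodI_min => // x w Ix.
move/(_ _ (ideal_colon (IO _ Ix) iT)) => /= h.
have [|] // := h.
move=> y z Jy Lz; split; first by apply: O_mul; [apply: JO | apply: LO].
by rewrite mulrA; apply: prodI_mem => //; apply: prodI_mem.
Qed.

Lemma prodIA I J L : integral_ideal I -> integral_ideal J -> integral_ideal L ->
  prodI I (prodI J L) = prodI (prodI I J) L.
Proof.
move=> iI iJ iL; apply/seteqP; split; first exact: prodI_assoc_sub.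
by rewrite prodIC (prodIC I J) (prodIC I) (prodIC J L); apply: prodI_assoc_sub.
Qed.

Lemma prodI1 I : integral_ideal I -> prodI O I = I.
Proof.
move=> iI; apply/seteqP; split.
  by apply: prodI_min => //; case: iI => _ _ _.
by move=> x Ix; rewrite -[x]mul1r; apply: prodI_mem => //; apply: O_1.
Qed.

Definition scaleI (a : K) (I : set K) : set K := [set a * x | x in I].

Lemma scaleI_mem a I x : I x -> scaleI a I (a * x). Proof. by exists x. Qed.

Lemma ideal_scaleI a I : O a -> integral_ideal I -> integral_ideal (scaleI a I).
Proof.
move=> Oa [IO I0 ID IM]; split.
- by move=> _ [x Ix <-]; apply: O_mul => //; apply: IO.
- by exists 0; rewrite ?mulr0.
- by move=> _ _ [x Ix <-] [y Iy <-]; exists (x + y); [apply: ID | rewrite mulrDr].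
- by move=> b _ Ob [x Ix <-]; exists (b * x); [apply: IM | rewrite mulrCA].
Qed.

Lemma scaleIM a b I : scaleI a (scaleI b I) = scaleI (a * b) I.
Proof.
apply/seteqP; split=> [_ [_ [x Ix <-] <-] | _ [x Ix <-]].
  by exists x; rewrite ?mulrA.
by exists (b * x); [apply: scaleI_mem | rewrite mulrA].
Qed.

Lemma scaleI1 I : scaleI 1 I = I.
Proof.
apply/seteqP; split=> [_ [x Ix <-] | x Ix]; first by rewrite mul1r.
by exists x; rewrite ?mul1r.
Qed.

Lemma prodI_scale a I J : O a -> integral_ideal I -> integral_ideal J ->
  prodI (scaleI a I) J = scaleI a (prodI I J).
Proof.
move=> Oa iI iJ; have iIJ := ideal_prodI iI iJ; apply/seteqP; split.
  apply: prodI_min; first exact: ideal_scaleI.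
  by move=> _ y [x Ix <-] Jy; exists (x * y); [apply: prodI_mem | rewrite mulrA].
move=> _ [z hz <-]; have iT := ideal_prodI (ideal_scaleI Oa iI) iJ.
case: (iI) => IO _ _ _; case: (iJ) => JO _ _ _.
have [|] // := hz _ (ideal_colon Oa iT).
move=> x y Ix Jy; split; first by apply: O_mul; [apply: IO | apply: JO].
by rewrite mulrA; apply: prodI_mem => //; apply: scaleI_mem.
Qed.

Lemma ideal_equiv_refl I : ideal_equiv I I.
Proof. by exists 1, 1; split=> //; try apply: O_1; apply: oner_neq0. Qed.

Lemma ideal_equiv_sym I J : ideal_equiv I J -> ideal_equiv J I.
Proof. by move=> [a [b [Oa Ob a0 b0 e]]]; exists b, a; split. Qed.

Lemma ideal_equiv_trans I J L : ideal_equiv I J -> ideal_equiv J L -> ideal_equiv I L.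
Proof.
move=> [a [b [Oa Ob a0 b0 e]]] [c [d [Oc Od c0 d0 e']]].
exists (c * a), (b * d); split; try exact: O_mul; try exact: mulf_neq0.
rewrite -/(scaleI (c * a) I) -/(scaleI (b * d) L) -!scaleIM.
by rewrite [scaleI a I]e -[scaleI d L]e' !scaleIM mulrC.
Qed.

Lemma ideal_equiv_scale a I : O a -> a != 0 -> ideal_equiv (scaleI a I) I.
Proof.
move=> Oa a0; exists 1, a; split=> //; try apply: O_1; try apply: oner_neq0.
exact: scaleI1.
Qed.

Lemma ideal_equiv_prodI I I' J : integral_ideal I -> integral_ideal I' -> integral_ideal J ->
  ideal_equiv I I' -> ideal_equiv (prodI I J) (prodI I' J).
Proof.
move=> iI iI' iJ [a [b [Oa Ob a0 b0 e]]]; exists a, b; split=> //.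
by rewrite -/(scaleI a _) -/(scaleI b _) -!prodI_scale // [scaleI a I]e.
Qed.

Lemma ideal_class_eq I J : nonzero_ideal J ->
  ideal_class I = ideal_class J <-> ideal_equiv I J.
Proof.
move=> nJ; split=> [e | e].
  by have [] : ideal_class I J by rewrite e; split=> //; apply: ideal_equiv_refl.
apply/seteqP; split=> L [nL eL]; split=> //.
  exact: ideal_equiv_trans (ideal_equiv_sym e) eL.
exact: ideal_equiv_trans e eL.
Qed.

Definition powI (I : set K) (n : nat) := iter n (prodI I) O.

Lemma ideal_powI I n : integral_ideal I -> integral_ideal (powI I n).
Proof. by move=> iI; elim: n => [|n IHn]; [apply: ideal_O | apply: ideal_prodI]. Qed.

Lemma nonzero_powI I n : nonzero_ideal I -> nonzero_ideal (powI I n).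
Proof. by move=> iI; elim: n => [|n IHn]; [apply: nonzero_ideal_O | apply: nonzero_prodI]. Qed.

Lemma powI_prodI I J n : integral_ideal I -> integral_ideal J ->
  powI (prodI I J) n = prodI (powI I n) (powI J n).
Proof.
move=> iI iJ; elim: n => [|n IHn]; first by rewrite [RHS]prodI1 //; apply: ideal_O.
have [iIn iJn] := (ideal_powI n iI, ideal_powI n iJ).
rewrite [LHS]/= -/(powI _ n) IHn [powI I n.+1]/= [powI J n.+1]/= -/(powI I n) -/(powI J n).
rewrite -!prodIA //; try exact: ideal_prodI.
by congr prodI; rewrite !prodIA // (prodIC J).
Qed.

Lemma powI_equiv I J n : integral_ideal I -> integral_ideal J ->
  ideal_equiv I J -> ideal_equiv (powI I n) (powI J n).
Proof.
move=> iI iJ e; elim: n => [|n IHn]; first exact: ideal_equiv_refl.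
have [iIn iJn] := (ideal_powI n iI, ideal_powI n iJ).
apply: ideal_equiv_trans (ideal_equiv_prodI iI iJ iIn e) _.
by rewrite prodIC [powI J _]prodIC; apply: ideal_equiv_prodI.
Qed.

Lemma powI_O n : powI O n = O.
Proof. by elim: n => [|n IHn] //; rewrite /= -/(powI O n) IHn prodI1 //; apply: ideal_O. Qed.

(** Classes are multiplied through chosen representatives; [cls_eq] and [ideal_equiv_prodI] make the
    result independent of the choice. *)
Lemma class_number_prime_dvd (n h : nat) :
  finite_set (@ideal_classes K) -> (0 < n)%N ->
  (forall I, nonzero_ideal I -> ideal_equiv (powI I n) O) ->
  prime h -> (h %| class_number K)%N -> (h %| n)%N.
Proof.
move=> fin n0 triv h_pr hcl.
pose S := fset_set (@ideal_classes K).
have mem_cls I : nonzero_ideal I -> ideal_class I \in S.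
  by move=> nI; rewrite in_fset_set // inE; exists I.
pose c0 : S := [` mem_cls _ nonzero_ideal_O]%fset.
pose cls (I : set K) : S := insubd c0 (ideal_class I).
have val_cls I : nonzero_ideal I -> val (cls I) = ideal_class I.
  by move=> nI; rewrite val_insubd mem_cls.
have [rep rep_nz rep_cls] : exists2 rep : S -> set K, forall c, nonzero_ideal (rep c) &
    forall c, cls (rep c) = c.
  have h1 (c : S) : exists I, nonzero_ideal I /\ cls I = c.
    have := valP c; rewrite in_fset_set // inE => -[I nI Ic].
    by exists I; split=> //; apply: val_inj; rewrite val_cls.
  exists (fun c => projT1 (cid (h1 c))) => c; by case: (cid (h1 c)) => I [].
have cls_eq I J : nonzero_ideal I -> nonzero_ideal J -> cls I = cls J <-> ideal_equiv I J.
  move=> nI nJ; rewrite -(ideal_class_eq I nJ) -(val_cls _ nI) -(val_cls _ nJ).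
  by split=> [-> // | /val_inj].
pose op c d := cls (prodI (rep c) (rep d)).
have op_cls I J : nonzero_ideal I -> nonzero_ideal J -> op (cls I) (cls J) = cls (prodI I J).
  move=> nI nJ; have [iI iJ] : integral_ideal I /\ integral_ideal J by case: nI; case: nJ.
  have nR c : integral_ideal (rep c) by case: (rep_nz c).
  apply/cls_eq; try exact: nonzero_prodI.
  have eI : ideal_equiv (rep (cls I)) I by apply/cls_eq => //; rewrite rep_cls.
  have eJ : ideal_equiv (rep (cls J)) J by apply/cls_eq => //; rewrite rep_cls.
  apply: ideal_equiv_trans (ideal_equiv_prodI (nR _) iI (nR _) eI) _.
  by rewrite prodIC (prodIC I); apply: ideal_equiv_prodI.
have iR c : integral_ideal (rep c) by case: (rep_nz c).
apply: (@cauchy_monoid S op c0 n h) => //.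
- move=> a b c; rewrite -(rep_cls a) -(rep_cls b) -(rep_cls c).
  rewrite !op_cls //; try exact: nonzero_prodI.
  by rewrite prodIA.
- by move=> a b; rewrite /op prodIC.
- move=> a; rewrite -(rep_cls a).
  have -> : c0 = cls O by apply: val_inj; rewrite val_cls //; apply: nonzero_ideal_O.
  by rewrite op_cls ?prodI1 //; apply: nonzero_ideal_O.
- move=> a; have -> : c0 = cls O by apply: val_inj; rewrite val_cls //; apply: nonzero_ideal_O.
  rewrite -{1}(rep_cls a).
  have -> k : iter k (op (cls (rep a))) (cls O) = cls (powI (rep a) k).
    elim: k => [|k IHk] //; rewrite iterS IHk op_cls //; exact: nonzero_powI.
  apply/cls_eq; [exact: nonzero_powI | exact: nonzero_ideal_O | exact: triv].
- by rewrite -cardfE.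
Qed.

End IdealMonoid.

(** * Ideals of the ring of integers of Q(sqrt(-p)) *)

Lemma int_subgroup_gen (P : int -> Prop) :
  (forall x y, P x -> P y -> P (x - y)) -> (exists2 x, P x & x != 0) ->
  exists g : nat, [/\ (0 < g)%N, P g%:Z & forall x, P x -> (g%:Z %| x)%Z].
Proof.
move=> PB [x0 Px0 x00].
have P0 : P 0 by rewrite -(subrr x0); apply: PB.
have PN x : P x -> P (- x) by move=> Px; rewrite -sub0r; apply: PB.
have PD x y : P x -> P y -> P (x + y) by move=> Px Py; rewrite -(opprK y); apply: PB => //; apply: PN.
have PMn (k : nat) x : P x -> P (k%:Z * x).
  by move=> Px; elim: k => [|k IHk]; rewrite ?mul0r // -addn1 PoszD mulrDl mul1r; apply: PD.
have PM (k : int) x : P x -> P (k * x).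
  by move=> Px; case: k => k; [apply: PMn | rewrite NegzE mulNr; apply: PN; apply: PMn].
have ex : exists n : nat, (0 < n)%N && `[< P n%:Z >].
  exists `|x0|%N; rewrite absz_gt0 x00; apply/asboolP.
  by case: (intP x0) Px0 => // n /PN; rewrite ?opprK // abszN.
case: (ex_minnP ex) => g /andP[g0 /asboolP Pg] gmin.
exists g; split=> // x Px; apply/dvdz_mod0P.
have Pr : P (x %% g)%Z by rewrite /modz; apply: PB => //; apply: PM.
have gz : g%:Z != 0 by rewrite eqz_nat -lt0n.
have rg : (x %% g%:Z)%Z < g%:Z by apply: ltz_pmod; rewrite ltz_nat.
have := modz_ge0 x gz; move: (x %% g%:Z)%Z Pr rg => [] // r Pr; rewrite ltz_nat => rg _.
congr Posz; apply/eqP; rewrite -leqn0 leqNgt; apply/negP => r0.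
have := gmin r; rewrite r0 /=; have -> : `[< P r%:Z >] by apply/asboolP.
by move=> /(_ isT); rewrite leqNgt rg.
Qed.

(** The descent step: 4 a a' = (2 b - 1)^2 + P is at most a^2 + P, and P < a. *)
Lemma reduce_bound (P c a b a' : int) : 4 * c = P + 1 -> 0 < P -> P < a ->
  - a <= 2 * b - 1 <= a -> b ^+ 2 - b + c = a * a' -> 0 < a' < a.
Proof.
move=> Dc P0 Pa /andP[b1 b2] Dq.
have D4 : 4 * (a * a') = (2 * b - 1) ^+ 2 + P by rewrite -Dq mulrDr Dc; ring.
have bnd : (2 * b - 1) ^+ 2 <= a ^+ 2.
  rewrite -subr_ge0 subr_sqr mulr_ge0 //; lia.
have sq0 : 0 <= (2 * b - 1) ^+ 2 by apply: sqr_ge0.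
have a0 : 0 < a by lia.
apply/andP; split; rewrite ltNge; apply/negP => h.
  have : a * a' <= 0 by rewrite pmulr_rle0.
  by move: D4 sq0 P0; clear; lia.
have : a * a <= a * a' by rewrite ler_pM2l.
have : a <= a * a by rewrite ler_pMr //; move: a0; clear; lia.
move: D4 bnd Pa P0; rewrite (expr2 a); move: ((2 * b - 1) ^+ 2) (a * a') (a * a); clear; lia.
Qed.

Section QuadraticField.

Variables (K : fieldExtType rat) (p : nat) (s : K).
Hypotheses (p_pr : prime p) (p3 : p = 3 %[mod 4]).
Hypotheses (s2 : s ^+ 2 = (- p%:Z)%:~R) (gen_s : <<1; s>>%VS = fullv).
Local Open Scope classical_set_scope.

Let c := (p.+1 %/ 4)%N.
Let c4 : 4 * c%:Z = p%:Z + 1.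
Proof. by rewrite -[4]/(4%N%:Z) -PoszM quarter_succ // -addn1. Qed.

Notation O := (@ring_of_integers K).

Let ia : {rmorphism rat -> K} := in_alg K.

Let intrK_inj : injective (intr : int -> K).
Proof. by move=> m n; rewrite -!(rmorph_int ia) => /fmorph_inj; apply: intr_inj. Qed.

Let n2 : (2 : K) != 0.
Proof. by rewrite -[2]/(2%:Z%:~R) -[0]/((0 : int)%:~R) (inj_eq intrK_inj). Qed.

(** It satisfies the same quadratic equation as the period [eta], so the norm form found by
    Stickelberger's theorem is the norm of K in this basis. *)
Definition theta : K := (s - 1) / 2.

Lemma s_theta : s = 2 * theta + 1.
Proof. by rewrite /theta mulrC divfK // subrK. Qed.

Lemma theta_sqr : theta ^+ 2 = - theta - c%:R.
Proof.
have n4 : (4 : K) != 0 by rewrite -[4]/(4%:Z%:~R) -[0]/((0 : int)%:~R) (inj_eq intrK_inj).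
apply: (mulfI n4).
have -> : 4 * (- theta - c%:R) = - (4 * theta) - (4 * c%:Z)%:~R by rewrite rmorphM /= -!pmulrn; ring.
rewrite c4 rmorphD /= -pmulrn; have := s2; rewrite s_theta rmorphN /= -pmulrn => h.
have -> : 4 * theta ^+ 2 = (2 * theta + 1) ^+ 2 - 4 * theta - 1 by ring.
by rewrite h; ring.
Qed.

(** Otherwise s would be rational, with the negative square -p. *)
Lemma theta_not_rat (q r : rat) : ia q + ia r * theta = 0 -> q = 0 /\ r = 0.
Proof.
move=> h; have [r0|r0] := eqVneq r 0.
  split=> //; move: h; rewrite r0 rmorph0 mul0r addr0 => /eqP.
  by rewrite fmorph_eq0 => /eqP.
have Dtheta : theta = ia (- q / r).
  have rA : ia r != 0 by rewrite fmorph_eq0.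
  apply: (mulfI rA); rewrite -rmorphM; have -> : r * (- q / r) = - q by rewrite mulrC divfK.
  by apply/eqP; rewrite rmorphN -addr_eq0 addrC h.
exfalso; have := s2; rewrite s_theta Dtheta.
have -> : 2 * ia (- q / r) + 1 = ia (2 * (- q / r) + 1).
  by move: (- q / r) => y; rewrite rmorphD rmorphM rmorph1 rmorph_nat.
rewrite -(rmorph_int ia) -rmorphXn => /fmorph_inj h'.
have := sqr_ge0 (2 * (- q / r) + 1); rewrite h' ler0z oppr_ge0 lez_nat leqn0.
by have := prime_gt1 p_pr; case: (p).
Qed.

Lemma coords_rat (x : K) : exists q r : rat, x = ia q + ia r * theta.
Proof.
have : x \in <<1; s>>%VS by rewrite gen_s memvf.
case/Fadjoin_polyP => f fo ->{x}.
have step (y : K) : (exists q r : rat, y = ia q + ia r * s) ->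
   exists q r : rat, y = ia q + ia r * theta.
  move=> [q [r ->]]; exists (q + r), (2 * r).
  rewrite s_theta rmorphD rmorphM rmorph_nat; ring.
apply: step; elim/poly_ind: f fo => [|f a IHf] fo.
  by exists 0, 0; rewrite horner0 !rmorph0 mul0r addr0.
have [b Db] : exists b : rat, a = ia b.
  have := polyOverP fo 0; rewrite coefD coefMX coefC /= add0r => /vlineP[b ->].
  by exists b.
have [|q [r Dqr]] := IHf.
  apply/polyOverP => i; have := polyOverP fo i.+1.
  by rewrite coefD coefMX coefC /= addr0.
exists (b - p%:R * r), q; rewrite !hornerE Dqr Db.
rewrite rmorphB rmorphM rmorph_nat mulrDl -mulrA -expr2 s2 rmorphN /= -pmulrn.
ring.
Qed.

Definition mk (a b : int) : K := a%:~R + b%:~R * theta.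

Lemma mk_inj a b a' b' : mk a b = mk a' b' -> a = a' /\ b = b'.
Proof.
move=> h; have : ia (a - a')%:~R + ia (b - b')%:~R * theta = 0.
  rewrite !rmorph_int !rmorphB /=.
  have -> : a%:~R - a'%:~R + (b%:~R - b'%:~R) * theta = mk a b - mk a' b' by rewrite /mk; ring.
  by rewrite h subrr.
by case/theta_not_rat => /eqP; rewrite intr_eq0 subr_eq0 => /eqP -> /eqP;
  rewrite intr_eq0 subr_eq0 => /eqP ->.
Qed.

Lemma mkD a b a' b' : mk a b + mk a' b' = mk (a + a') (b + b').
Proof. by rewrite /mk !rmorphD /=; ring. Qed.

Lemma mkN a b : - mk a b = mk (- a) (- b).
Proof. by rewrite /mk !rmorphN /=; ring. Qed.

Lemma mkB a b a' b' : mk a b - mk a' b' = mk (a - a') (b - b').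
Proof. by rewrite mkN mkD. Qed.

Lemma mkM a b a' b' :
  mk a b * mk a' b' = mk (a * a' - c%:Z * (b * b')) (a * b' + b * a' - b * b').
Proof.
rewrite /mk !(rmorphD, rmorphB, rmorphM) /= -?pmulrn.
transitivity (a%:~R * a'%:~R + (a%:~R * b'%:~R + b%:~R * a'%:~R) * theta
  + b%:~R * b'%:~R * theta ^+ 2); first by ring.
by rewrite theta_sqr; ring.
Qed.

Lemma mk_int a : mk a 0 = a%:~R.
Proof. by rewrite /mk mul0r addr0. Qed.

Lemma O_theta : O theta.
Proof.
exists ('X^2 + 'X + (c%:Z)%:P).
  rewrite monicE -addrA lead_coefDl ?lead_coefXn // size_polyXn.
  by apply: leq_ltn_trans (size_polyD _ _) _; rewrite size_polyX size_polyC gtn_max; case: eqP.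
rewrite rootE !rmorphD /= map_polyXn map_polyX map_polyC /= !hornerE theta_sqr.
by apply/eqP; rewrite -?pmulrn; ring.
Qed.

Lemma O_mk a b : O (mk a b).
Proof. by apply: O_add; [apply: O_int | apply: O_mul; [apply: O_int | apply: O_theta]]. Qed.

(** * The ring of integers is Z[theta] *)

Lemma Aint_rat_int (q : rat) : ratr q \in Aint -> exists a : int, q = a%:~R.
Proof.
move=> Aq; apply/intrP; rewrite -Cint_rat; apply: Cint_rat_Aint => //; exact: Crat_rat.
Qed.

Lemma monic_root_Aint (F : {poly int}) (z : algC) :
  F \is monic -> root (map_poly intr F) z -> z \in Aint.
Proof.
move=> mF rz; apply: root_monic_Aint rz _ _.
  exact: monic_map.
by apply/polyOverP => i; rewrite coef_map; apply: rpred_int.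
Qed.

(** Over algC the roots of the quadratic are roots of F, hence algebraic integers; t is their sum
    and n their product. *)
Lemma quadratic_int (F : {poly int}) (t n : rat) : F \is monic ->
  'X^2 - t *: 'X + n%:P %| map_poly intr F ->
  (exists a : int, t = a%:~R) /\ (exists a : int, n = a%:~R).
Proof.
move=> mF dvd; set m := 'X^2 - t *: 'X + n%:P in dvd.
have DmC : map_poly ratr m = 'X^2 - ratr t *: 'X + (ratr n)%:P :> {poly algC}.
  by rewrite /m rmorphD rmorphB /= map_polyXn map_polyZ map_polyX map_polyC.
have root_Aint z : root (map_poly ratr m) z -> z \in Aint.
  move=> rz; apply: (monic_root_Aint mF).
  have -> : map_poly intr F = map_poly ratr (map_poly intr F : {poly rat}) :> {poly algC}.
    by rewrite -map_poly_comp; apply: eq_map_poly => i /=; rewrite rmorph_int.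
  by case/dvdpP: dvd => Q ->; rewrite rmorphM rootM rz orbT.
have [z1 r1] : exists z, root (map_poly ratr m : {poly algC}) z.
  apply/closed_rootP; rewrite size_map_poly.
  by rewrite /m -addrA size_polyDl size_polyXn // (leq_ltn_trans (size_polyD _ _)) //
    gtn_max size_polyN (leq_ltn_trans (size_scale_leq _ _)) ?size_polyX // size_polyC; case: eqP.
have e1 : z1 ^+ 2 - ratr t * z1 + ratr n = 0.
  by move: r1; rewrite rootE DmC !hornerE => /eqP.
have r2 : root (map_poly ratr m) (ratr t - z1).
  rewrite rootE DmC !hornerE; apply/eqP; rewrite -[RHS]e1; ring.
have [A1 A2] := (root_Aint _ r1, root_Aint _ r2).
split; apply: Aint_rat_int.
  by rewrite -(subrKC z1 (ratr t)) rpredD.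
have -> : ratr n = z1 * (ratr t - z1).
  by rewrite -[RHS]addr0 -e1; ring.
exact: rpredM.
Qed.

Lemma sqr_int_rat (y : rat) (w : int) : y ^+ 2 = w%:~R -> exists e : int, y = e%:~R.
Proof.
move=> h; apply: Aint_rat_int; apply: (@monic_root_Aint ('X^2 - w%:P)).
  by rewrite monicE lead_coefDl ?lead_coefXn // size_polyXn size_polyN size_polyC; case: eqP.
rewrite rootE rmorphB /= map_polyXn map_polyC /= !hornerE -rmorphXn h /=.
by rewrite rmorph_int subrr.
Qed.

Lemma prime_sqr_int (r : rat) (w : int) : p%:R * r ^+ 2 = w%:~R -> exists e : int, r = e%:~R.
Proof.
move=> h; have p0 : (p%:R : rat) != 0 by rewrite pnatr_eq0 -lt0n prime_gt0.
have [e De] : exists e : int, p%:R * r = e%:~R.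
  apply: (@sqr_int_rat _ (p%:Z * w)).
  rewrite rmorphM /= -h -pmulrn; ring.
have De2 : e ^+ 2 = p%:Z * w.
  apply: (@intr_inj rat); rewrite rmorphXn rmorphM /= -De -h -pmulrn; ring.
have : (p%:Z %| e)%Z.
  have : (p%:Z %| e ^+ 2)%Z by rewrite De2 dvdz_mulr.
  by rewrite !dvdzE abszX /= Euclid_dvdX // andbT.
case/dvdzP => e' De'; exists e'; apply: (mulfI p0).
by rewrite De De' rmorphM /= -pmulrn mulrC.
Qed.

(** The trace t and norm n of q + r theta are integers, and p r^2 = 4 n - t^2. As p is squarefree, r
    is an integer; then so is q, by the parity argument of [half_sum_int]. *)
Lemma O_mkP x : O x <-> exists a b, x = mk a b.
Proof.
split; last by move=> [a [b ->]]; apply: O_mk.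
have [q [r Dx]] := coords_rat x; case=> F mF rF.
pose fQ : {poly rat} := map_poly intr F.
have rfQ : (map_poly ia fQ).[x] = 0.
  apply/eqP; rewrite -map_poly_comp; move: rF; rewrite rootE; congr (_.[_] == 0).
  by apply: eq_map_poly => i; rewrite -[RHS]/(ia i%:~R) rmorph_int.
have [r0|r0] := eqVneq r 0.
  have [a Da] : exists a : int, q = a%:~R.
    apply: Aint_rat_int; apply: (monic_root_Aint mF).
    have -> : map_poly intr F = map_poly ratr fQ :> {poly algC}.
      by rewrite -map_poly_comp; apply: eq_map_poly => i /=; rewrite rmorph_int.
    rewrite fmorph_root; move: rfQ; rewrite Dx r0 rmorph0 mul0r addr0 horner_map => /eqP.
    by rewrite fmorph_eq0.
  by exists a, 0; rewrite mk_int Dx r0 Da rmorph0 mul0r addr0 rmorph_int.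
pose t := 2%:R * q - r; pose n := q ^+ 2 - q * r + c%:R * r ^+ 2.
pose m : {poly rat} := 'X^2 - t *: 'X + n%:P.
have sm : size m = 3%N.
  by rewrite /m -addrA size_polyDl size_polyXn // (leq_ltn_trans (size_polyD _ _)) //
    gtn_max size_polyN (leq_ltn_trans (size_scale_leq _ _)) ?size_polyX // size_polyC; case: eqP.
have m0 : m != 0 by rewrite -size_poly_eq0 sm.
have rm : (map_poly ia m).[x] = 0.
  have -> : (map_poly ia m).[x] = x ^+ 2 - ia t * x + ia n.
    by rewrite /m rmorphD rmorphB /= map_polyXn map_polyZ map_polyX map_polyC !hornerE.
  have -> : ia t = 2 * ia q - ia r by rewrite /t rmorphB rmorphM rmorph_nat.
  have -> : ia n = ia q ^+ 2 - ia q * ia r + c%:R * ia r ^+ 2.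
    by rewrite /n rmorphD rmorphB rmorphXn 2!rmorphM rmorphXn rmorph_nat.
  rewrite Dx; move: (ia q) (ia r) => q' r'.
  transitivity (r' ^+ 2 * (theta ^+ 2 + theta + c%:R)); first by ring.
  by rewrite theta_sqr; ring.
(* The remainder has degree at most 1 and vanishes at x, which is not rational because r != 0; so it
   is zero. *)
have dvd : m %| fQ.
  rewrite /dvdp; set R := fQ %% m.
  have sR : (size R <= 2)%N by rewrite -ltnS -sm ltn_modp.
  have rR : (map_poly ia R).[x] = 0.
    have := rfQ; rewrite (divp_eq fQ m) rmorphD rmorphM hornerD hornerM rm mulr0 add0r.
    by [].
  have DR : R = (R`_1) *: 'X + (R`_0)%:P.
    apply/polyP => i; rewrite coefD coefZ coefX coefC.
    case: i => [|[|i]] /=; rewrite ?mulr0 ?mulr1 ?add0r ?addr0 //.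
    by rewrite nth_default // (leq_trans sR).
  have h : ia (R`_1 * q + R`_0) + ia (R`_1 * r) * theta = 0.
    have -> : ia (R`_1 * q + R`_0) = ia R`_1 * ia q + ia R`_0 by rewrite rmorphD rmorphM.
    have -> : ia (R`_1 * r) = ia R`_1 * ia r by rewrite rmorphM.
    rewrite -[RHS]rR; have -> : (map_poly ia R).[x] = ia R`_1 * x + ia R`_0.
      by rewrite [in LHS]DR rmorphD /= map_polyZ map_polyX map_polyC !hornerE.
    rewrite Dx; ring.
  have [h0 /eqP h1] := theta_not_rat h.
  move: h1; rewrite mulf_eq0 (negbTE r0) orbF => /eqP h1.
  move: h0; rewrite h1 mul0r add0r => h0.
  by rewrite DR h1 h0 scale0r add0r.
have [[T DT] [N DN]] := quadratic_int mF dvd.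
have hp : p%:R * r ^+ 2 = (4 * N - T ^+ 2)%:~R.
  rewrite rmorphB rmorphM rmorphXn /= -DT -DN /t /n.
  have -> : p%:R = 4%:R * c%:R - 1 :> rat.
    by rewrite -[p%:R]/((p%:Z)%:~R) -[p%:Z](addrK 1) -c4 rmorphB rmorphM.
  ring.
have [Z DZ] := prime_sqr_int hp.
have hN : T ^+ 2 + p%:Z * Z ^+ 2 = 4 * N.
  apply: (@intr_inj rat); rewrite rmorphD [X in _ + X]rmorphM !rmorphXn /= -DZ -pmulrn hp.
  by rewrite rmorphB /= rmorphXn addrC subrK.
have [A [DA _]] := half_sum_int c4 hN.
exists A, Z; suff Dq : q = A%:~R by rewrite Dx DZ Dq !rmorph_int.
have n2' : (2%:R : rat) != 0 by [].
apply: (mulfI n2'); have := congr1 (intr : int -> rat) DA.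
rewrite rmorphD rmorphM /= -DT -DZ /t => <-; ring.
Qed.

(* The module Z a + Z (b + theta), an ideal when a divides the norm qnorm b of b + theta. *)
Definition lat (a b : int) : set K :=
  [set x | exists y z, x = mk y z /\ (a %| y - z * b)%Z].

Definition qnorm (b : int) : int := b ^+ 2 - b + c%:Z.

Lemma lat_mk a b y z : lat a b (mk y z) <-> (a %| y - z * b)%Z.
Proof.
split; last by move=> h; exists y, z.
by move=> [y' [z' [/mk_inj[-> ->]]]].
Qed.

Lemma ideal_lat a b : (a %| qnorm b)%Z -> integral_ideal (lat a b).
Proof.
move=> /dvdzP[n Dn]; split.
- by move=> _ [y [z [-> _]]]; apply: O_mk.
- by exists 0, 0; rewrite mk_int mul0r subrr dvdz0.
- move=> _ _ [y [z [-> /dvdzP[k Dk]]]] [y' [z' [-> /dvdzP[k' Dk']]]].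
  rewrite mkD; apply/lat_mk; apply/dvdzP; exists (k + k').
  by rewrite [RHS]mulrDl -Dk -Dk'; ring.
- move=> x _ /O_mkP[u [v ->]] [y [z [-> /dvdzP[k Dk]]]].
  rewrite mkM; apply/lat_mk; apply/dvdzP; exists ((u - v * b) * k - v * z * n).
  transitivity ((u - v * b) * (k * a) - v * z * (n * a)); last by ring.
  by rewrite -Dk -Dn /qnorm; ring.
Qed.

Lemma intrK_neq0 (a : int) : a != 0 -> (a%:~R : K) != 0.
Proof. by move=> a0; rewrite -[0]/((0 : int)%:~R) (inj_eq intrK_inj). Qed.

Lemma lat_shift a b k : lat a (b + k * a) = lat a b.
Proof.
apply/seteqP; split=> _ [y [z [-> h]]]; apply/lat_mk.
  have -> : y - z * b = y - z * (b + k * a) + z * k * a by ring.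
  by rewrite rpredDr ?dvdz_mull.
have -> : y - z * (b + k * a) = y - z * b + (- z * k) * a by ring.
by rewrite rpredDr ?dvdz_mull.
Qed.

Lemma qnorm_shift a b k : (a %| qnorm b)%Z -> (a %| qnorm (b + k * a))%Z.
Proof.
move=> h; have -> : qnorm (b + k * a) = qnorm b + (2 * b * k + k * k * a - k) * a.
  by rewrite /qnorm; ring.
by rewrite rpredDr ?dvdz_mull.
Qed.

(** Let d generate the theta-coordinates of I, attained at e + d theta, and let g generate the
    integers in I. Multiplying by theta shows that d divides g and e, so d can be factored out. *)
Lemma ideal_lat_form I : nonzero_ideal I ->
  exists (d a : nat) b, [/\ (0 < d)%N, (0 < a)%N, (a%:Z %| qnorm b)%Z & I = scaleI d%:R (lat a b)].
Proof.
move=> [iI [x0 Ix0 x00]]; case: (iI) => IO I0 ID IM.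
have IB x y : I x -> I y -> I (x - y) by move=> Ix Iy; apply: ID => //; apply: ideal_opp.
have [u [v Dx0]] : exists u v, x0 = mk u v by apply/O_mkP; apply: IO.
have uv0 : (u != 0) || (v != 0).
  by apply: contraNT x00; rewrite negb_or !negbK => /andP[/eqP u0 /eqP v0]; rewrite Dx0 u0 v0 mk_int.
have [d [d0 [e Ie] dmin]] : exists d : nat, [/\ (0 < d)%N, exists e, I (mk e d%:Z)
    & forall z, (exists e, I (mk e z)) -> (d%:Z %| z)%Z].
  apply: (@int_subgroup_gen (fun z => exists e, I (mk e z))).
    by move=> z z' [e Ie] [e' Ie']; exists (e - e'); rewrite -mkB; apply: IB.
  have [v0|v0] := eqVneq v 0; last by exists v => //; exists u; rewrite -Dx0.
  exists u; last by move: uv0; rewrite v0 eqxx orbF.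
  have := IM (mk 0 1) x0 (O_mk _ _) Ix0; rewrite Dx0 v0 mkM => h; eexists.
  by rewrite !mulr0 !mul0r !mul1r !add0r !subr0 in h; apply: h.
have [g [g0 Ig gmin]] : exists g : nat, [/\ (0 < g)%N, I (mk g%:Z 0)
    & forall z, I (mk z 0) -> (g%:Z %| z)%Z].
  apply: (@int_subgroup_gen (fun z => I (mk z 0))).
    by move=> z z' Iz Iz'; rewrite -[0](subrr 0) -mkB; apply: IB.
  (* The multiplier is the conjugate of x0, so the product is a nonzero integer in I. *)
  have := IM (mk (u - v) (- v)) x0 (O_mk _ _) Ix0; rewrite Dx0 mkM => h.
  have x0' : mk (u - v) (- v) != 0.
    apply: contraTneq uv0 => h0; have [h1 h2] : u - v = 0 /\ - v = 0 by apply: mk_inj; rewrite h0 mk_int.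
    have v0 : v = 0 by rewrite -(opprK v) h2 oppr0.
    by move: h1; rewrite v0 subr0 => ->; rewrite eqxx.
  exists ((u - v) * u - c%:Z * (- v * v)).
    by move: h; congr (I (mk _ _)); ring.
  have := mulf_neq0 x0' x00; rewrite Dx0 mkM; apply: contraNneq => ->.
  have -> : (u - v) * v + - v * u - - v * v = 0 by ring.
  by rewrite mk_int.
have Ithe x y : I (mk x y) -> I (mk (- (c%:Z * y)) (x - y)).
  move=> Ixy; have := IM (mk 0 1) _ (O_mk _ _) Ixy; rewrite mkM.
  by congr (I (mk _ _)); ring.
have /dvdzP[a Da] : (d%:Z %| g%:Z)%Z.
  by apply: dmin; exists (- (c%:Z * 0)); have := Ithe _ _ Ig; rewrite subr0.
have /dvdzP[b Db] : (d%:Z %| e)%Z.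
  have : (d%:Z %| e - d%:Z)%Z by apply: dmin; eexists; apply: Ithe Ie.
  by move=> h; rewrite -(subrK d%:Z e) rpredD.
have a0 : 0 < a by have := g0; rewrite -ltz_nat Da pmulr_lgt0 // ltz_nat.
case: a Da a0 => // a Da a0; rewrite ltz_nat in a0.
have dK : (d%:R : K) = mk d%:Z 0 by rewrite mk_int -pmulrn.
exists d, a, b; split=> //.
  have dz : d%:Z != 0 by rewrite eqz_nat -lt0n.
  rewrite -(dvdz_mul2r dz) -Da; apply: gmin.
  (* Multiplying d (b + theta) by the conjugate of b + theta puts d times [qnorm b] among the
     integers of I. *)
  have := IM (mk (b - 1) (- 1)) _ (O_mk _ _) Ie; rewrite mkM Db /qnorm.
  by congr (I (mk _ _)); ring.
rewrite dK; apply/seteqP; split.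
  move=> x Ix; have [y [z Dx]] : exists y z, x = mk y z by apply/O_mkP; apply: IO.
  have /dvdzP[k Dk] : (d%:Z %| z)%Z by apply: dmin; exists y; rewrite -Dx.
  have /dvdzP[t Dt] : (g%:Z %| y - k * e)%Z.
    apply: gmin; have -> : mk (y - k * e) 0 = x - mk k 0 * mk e d%:Z.
      by rewrite Dx mkM mkB Dk; congr mk; ring.
    by apply: IB => //; apply: IM => //; apply: O_mk.
  exists (mk (t * a%:Z + k * b) k).
    by apply/lat_mk; rewrite addrK dvdz_mull.
  have Dy : y = t * g%:Z + k * e by rewrite -Dt subrK.
  by rewrite mkM Dx Dk Dy Da Db; congr mk; ring.
move=> _ [_ [y [z [-> /dvdzP[t Dt]]]] <-].
have -> : mk d%:Z 0 * mk y z = mk t 0 * mk g%:Z 0 + mk z 0 * mk e d%:Z.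
  have Dy : y = t * a%:Z + z * b by rewrite -Dt subrK.
  by rewrite !mkM mkD Da Db Dy; congr mk; ring.
by apply: ID; apply: IM => //; apply: O_mk.
Qed.

(* b - 1 - theta is the conjugate of b + theta. *)
Lemma lat_swap (a a' b : int) : a * a' = qnorm b ->
  scaleI (mk (b - 1) (-1)) (lat a b) = scaleI (mk a 0) (lat a' (1 - b)).
Proof.
move=> Dq; have key k z : mk (b - 1) (-1) * mk (k * a + z * b) z = mk a 0 * mk ((b - 1) * k + z * a') (- k).
  rewrite !mkM; congr mk; last by ring.
  have -> : a * ((b - 1) * k + z * a') = a * ((b - 1) * k) + z * (a * a') by ring.
  rewrite Dq /qnorm; ring.
apply/seteqP; split=> _ [_ [y [z [-> /dvdzP[k Dk]]]] <-].
  exists (mk ((b - 1) * k + z * a') (- k)).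
    by apply/lat_mk; apply/dvdzP; exists z; ring.
  by rewrite -key -Dk subrK.
exists (mk (- z * a + k * b) k); first by apply/lat_mk; rewrite addrK dvdz_mull.
rewrite key; congr (_ * mk _ _); last by rewrite opprK.
have Dy : y = k * a' + z * (1 - b) by rewrite -Dk subrK.
by rewrite Dy; ring.
Qed.

Lemma mk_neq0 a b : (a != 0) || (b != 0) -> mk a b != 0.
Proof.
apply: contraTneq => h; have [-> ->] : a = 0 /\ b = 0 by apply: mk_inj; rewrite h mk_int.
by rewrite eqxx.
Qed.

Lemma qnorm_sym b : qnorm (1 - b) = qnorm b.
Proof. by rewrite /qnorm; ring. Qed.

Lemma centered_residue (a : nat) (b : int) : (0 < a)%N ->
  exists k, - a%:Z <= 2 * (b + k * a%:Z) - 1 <= a%:Z.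
Proof.
move=> a0; have az : a%:Z != 0 by rewrite eqz_nat -lt0n.
have r0 := modz_ge0 b az; have r1 : (b %% a%:Z)%Z < a%:Z by apply: ltz_pmod; rewrite ltz_nat.
have Dr := divz_eq b a%:Z; move: (b %% a%:Z)%Z (b %/ a%:Z)%Z r0 r1 Dr => r q r0 r1 Dr.
have [h|h] := leP (2 * r - 1) a%:Z.
  exists (- q); have -> : b + - q * a%:Z = r by rewrite Dr; ring.
  by move: r0 r1 h a0; clear; lia.
exists (- q - 1); have -> : b + (- q - 1) * a%:Z = r - a%:Z by rewrite Dr; ring.
by move: r0 r1 h a0; clear; lia.
Qed.

Lemma lat_equiv_swap (a a' : nat) b : (0 < a)%N -> a%:Z * a'%:Z = qnorm b ->
  ideal_equiv (lat a b) (lat a' (1 - b)).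
Proof.
move=> a0 Dq; exists (mk (b - 1) (-1)), (mk a 0); split; try exact: O_mk.
- by apply: mk_neq0; rewrite oppr_eq0 oner_eq0 orbT.
- by apply: mk_neq0; rewrite eqz_nat -lt0n a0.
- exact: lat_swap.
Qed.

(** Reduction of binary quadratic forms: centre b modulo a, then exchange a for [qnorm b] / a, which
    is smaller as long as a exceeds p. *)
Lemma lat_reduce (a : nat) b : (0 < a)%N -> (a%:Z %| qnorm b)%Z ->
  exists (a' : nat) b', [/\ (0 < a')%N, (a' <= p)%N, (a'%:Z %| qnorm b')%Z
    & ideal_equiv (lat a b) (lat a' b')].
Proof.
have [n] := ubnP a; elim: n a b => // n IHn a b; rewrite ltnS => an a0 dq.
have [ap|pa] := leqP a p; first by exists a, b; split=> //; apply: ideal_equiv_refl.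
have [k hk] := centered_residue b a0.
have dq' := qnorm_shift k dq; rewrite -(lat_shift a b k).
move: (b + k * a%:Z) hk dq' => b1 hb1 /dvdzP[a' Da'].
have h : 0 < a' < a%:Z.
  by apply: reduce_bound c4 _ _ hb1 _; rewrite ?ltz_nat ?prime_gt0 // mulrC -Da'.
case: a' Da' h => // a' Da' /andP[a'0 a'a]; rewrite !ltz_nat in a'0 a'a.
have [|a2 [b2 [h1 h2 h3 h4]]] := IHn a' (1 - b1) (leq_trans a'a an) a'0.
  by rewrite qnorm_sym Da' dvdz_mulr.
exists a2, b2; split=> //; apply: ideal_equiv_trans h4; apply: lat_equiv_swap => //.
by rewrite Da' mulrC.
Qed.

(** Every class contains some [lat a r] with r < a <= p, since [lat] depends on b only modulo a. *)
Lemma finite_classes : finite_set (@ideal_classes K).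
Proof.
pose f (ij : 'I_p.+1 * 'I_p.+1) : set (set K) := ideal_class (lat ij.1 ij.2).
apply: (@sub_finite_set _ _ (range f)); last by apply: finite_image; apply: finite_finset.
move=> _ [I nI <-].
have [d [a [b [d0 a0 dq DI]]]] := ideal_lat_form nI.
have [a' [b' [a'0 a'p dq' e]]] := lat_reduce a0 dq.
have az : a'%:Z != 0 by rewrite eqz_nat -lt0n.
have Dr := divz_eq b' a'%:Z; have := modz_ge0 b' az.
have : (b' %% a'%:Z)%Z < a'%:Z by apply: ltz_pmod; rewrite ltz_nat.
move: (b' %% a'%:Z)%Z (b' %/ a'%:Z)%Z Dr => [] // r q Dr; rewrite ltz_nat => ra _.
have rp : (r < p.+1)%N by rewrite ltnS ltnW // (leq_trans ra).
have Dlat : lat a' b' = lat a' r by rewrite Dr addrC lat_shift.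
have dqr : (a'%:Z %| qnorm r)%Z.
  have -> : r%:Z = b' + (- q) * a'%:Z by rewrite Dr; ring.
  exact: qnorm_shift.
exists (Ordinal (a'p : (a' < p.+1)%N), Ordinal rp) => //.
apply/ideal_class_eq => //; apply: ideal_equiv_sym; apply: ideal_equiv_trans (_ : ideal_equiv (lat a b) _).
  rewrite DI; apply: ideal_equiv_scale; first by rewrite pmulrn; apply: O_int.
  by rewrite pmulrn; apply: intrK_neq0; rewrite eqz_nat -lt0n.
by rewrite /= -Dlat.
Qed.

Lemma lat_theta a b : lat a b (mk b 1).
Proof. by apply/lat_mk; rewrite mul1r subrr dvdz0. Qed.

Lemma lat_self a b : lat a b (mk a 0).
Proof. by apply/lat_mk; rewrite mul0r subr0 dvdzz. Qed.

Lemma disc_qnorm b : (2 * b - 1) ^+ 2 + p%:Z = 4 * qnorm b.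
Proof. by rewrite /qnorm mulrDr c4; ring. Qed.

Lemma prime_coprimez (l : nat) (x : int) : prime l -> ~~ (l%:Z %| x)%Z ->
  exists u v, u * l%:Z + v * x = 1.
Proof.
move=> l_pr nd; have /coprimezP[[u v] /= h] : coprimez l%:Z x.
  by rewrite coprimezE /= prime_coprime.
by exists u, v.
Qed.

(** The point is that b + theta lies in the product T, which contains its multiples by l, by a and
    by 2 b - 1. If l does not divide a, the first two suffice. If it does, l^2 divides [qnorm b], so
    l cannot divide 2 b - 1: l^2 would divide p. *)
Lemma lat_factor (l a : nat) b : prime l -> (0 < a)%N -> ((l * a)%N%:Z %| qnorm b)%Z ->
  lat (l * a)%N b = prodI (lat l b) (lat a b).
Proof.
move=> l_pr a0 dq.
have dql : (l%:Z %| qnorm b)%Z by apply: dvdz_trans dq; rewrite PoszM dvdz_mulr.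
have dqa : (a%:Z %| qnorm b)%Z by apply: dvdz_trans dq; rewrite PoszM dvdz_mull.
have iP := ideal_prodI (ideal_lat dql) (ideal_lat dqa).
case: (iP) => _ _ PD PM; apply/seteqP; split; last first.
  apply: prodI_min; first exact: ideal_lat.
  move=> _ _ [y [z [-> /dvdzP[k Dk]]]] [y' [z' [-> /dvdzP[k' Dk']]]].
  have /dvdzP[n Dn] := dq.
  have -> : y = k * l%:Z + z * b by rewrite -Dk subrK.
  have -> : y' = k' * a%:Z + z' * b by rewrite -Dk' subrK.
  rewrite mkM; apply/lat_mk; apply/dvdzP; exists (k * k' - z * z' * n).
  transitivity (k * k' * (l * a)%N%:Z - z * z' * (n * (l * a)%N%:Z)); last by ring.
  by rewrite -Dn PoszM /qnorm; ring.
set T := prodI _ _ in iP PD PM *.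
have Tla : T (mk (l * a)%N 0).
  have -> : mk (l * a)%N 0 = mk l 0 * mk a 0 by rewrite mkM PoszM; congr mk; ring.
  by apply: prodI_mem; apply: lat_self.
have Tl : T (mk l 0 * mk b 1) by apply: prodI_mem; [apply: lat_self | apply: lat_theta].
have Ta : T (mk a 0 * mk b 1) by rewrite mulrC; apply: prodI_mem; [apply: lat_theta | apply: lat_self].
have T2 : T (mk (2 * b - 1) 0 * mk b 1).
  have /dvdzP[n Dn] := dq.
  have -> : mk (2 * b - 1) 0 * mk b 1 = mk b 1 * mk b 1 + mk n 0 * mk (l * a)%N 0.
    rewrite !mkM mkD; congr mk; last by ring.
    rewrite (_ : n * (l * a)%N%:Z = qnorm b) -?Dn // /qnorm; ring.
  by apply: PD; [apply: prodI_mem; apply: lat_theta | apply: PM => //; apply: O_mk].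
have Tb : T (mk b 1).
  have comb x y : T (mk x 0 * mk b 1) -> T (mk y 0 * mk b 1) ->
      (exists u v, u * x + v * y = 1) -> T (mk b 1).
    move=> Tx Ty [u [v uv]].
    have -> : mk b 1 = mk u 0 * (mk x 0 * mk b 1) + mk v 0 * (mk y 0 * mk b 1).
      rewrite !mkM mkD; congr mk.
        by transitivity ((u * x + v * y) * b); [rewrite uv mul1r | ring].
      by transitivity (u * x + v * y); [rewrite uv | ring].
    by apply: PD; apply: PM => //; apply: O_mk.
  have [la|nla] := boolP (l%:Z %| a%:Z)%Z; last exact: comb Tl Ta (prime_coprimez l_pr nla).
  apply: comb Tl T2 (prime_coprimez l_pr _); apply/negP => lb.
  have : ((l * l)%N%:Z %| p%:Z)%Z.
    have -> : p%:Z = 4 * qnorm b - (2 * b - 1) ^+ 2 by rewrite -disc_qnorm addrC addKr.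
    apply: rpredB; last by rewrite expr2 PoszM dvdz_mul.
    by apply: dvdz_mull; apply: dvdz_trans dq; rewrite !PoszM dvdz_mul.
  rewrite dvdzE /= => d; have lp : l = p by apply/eqP; rewrite -dvdn_prime2 // (dvdn_trans _ d) // dvdn_mulr.
  by move: d; rewrite lp => /(dvdn_leq (prime_gt0 p_pr)); have := prime_gt1 p_pr; clear; nia.
move=> _ [y [z [-> /dvdzP[k Dk]]]].
have -> : mk y z = mk k 0 * mk (l * a)%N 0 + mk z 0 * mk b 1.
  by rewrite !mkM mkD; congr mk; [rewrite -[y](subrK (z * b)) Dk; ring | ring].
by apply: PD; apply: PM => //; apply: O_mk.
Qed.

Lemma lat1 b : lat 1 b = O.
Proof.
apply/seteqP; split; first by move=> _ [y [z [-> _]]]; apply: O_mk.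
by move=> x /O_mkP[y [z ->]]; apply/lat_mk; apply: dvd1z.
Qed.

(** The ideal above p is generated by s = 1 + 2 theta, a square root of -p. *)
Lemma lat_ramified b : (p%:Z %| qnorm b)%Z -> ideal_equiv (lat p b) O.
Proof.
move=> dq; have [_ _ LD LM] := ideal_lat dq.
have /dvdzP[k Dk] : (p%:Z %| 2 * b - 1)%Z.
  have : (p%:Z %| (2 * b - 1) ^+ 2)%Z.
    have -> : (2 * b - 1) ^+ 2 = 4 * qnorm b - p%:Z by rewrite -disc_qnorm addrK.
    by apply: rpredB; [apply: dvdz_mull | apply: dvdzz].
  by rewrite !dvdzE abszX /= Euclid_dvdX // andbT.
have [j Dj] : exists j, k = 2 * j + 1.
  have [[j Dj]|[j Dj]] : (exists j, k = 2 * j) \/ (exists j, k = 2 * j + 1).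
    have := divz_eq k 2; have := modz_ge0 k (isT : (2 : int) != 0).
    have := @ltz_pmod k 2 isT; move: (k %/ 2)%Z (k %% 2)%Z => q r h1 h2 h3.
    have [r0|r0] : r = 0 \/ r = 1 by move: h1 h2; clear; lia.
      by left; exists q; rewrite h3 r0; ring.
    by right; exists q; rewrite h3 r0; ring.
    exfalso; move: Dk; rewrite Dj -mulrA; move: (j * p%:Z) => x; clear; lia.
  by exists j.
have Ds : s = mk 1 2 by rewrite /mk s_theta addrC.
have s0 : s != 0 by rewrite Ds mk_neq0.
suff -> : lat p b = scaleI s O by apply: ideal_equiv_scale; rewrite // Ds; apply: O_mk.
rewrite Ds; apply/seteqP; split; last first.
  move=> _ [x Ox <-]; rewrite mulrC; apply: LM => //; apply/lat_mk.
  by rewrite -opprB rpredN Dk dvdz_mull.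
move=> _ [y [z [-> /dvdzP[t Dt]]]].
(* Division by s: t p = s (- t s) because s^2 = -p, and b + theta = - s (j + k theta). *)
exists (mk (- t) (- (2 * t)) + mk (- (z * j)) (- (z * k))); first by apply: O_add; apply: O_mk.
rewrite mkD mkM; have Dy : y = t * p%:Z + z * b by rewrite -Dt subrK.
have Dp : p%:Z = 4 * c%:Z - 1 by rewrite c4 addrK.
have Db : b = 2 * k * c%:Z - j.
  have two : (2 : int) != 0 by [].
  apply: (mulfI two); have : 2 * b = k * p%:Z + 1 by rewrite -Dk subrK.
  by rewrite Dp Dj => ->; ring.
rewrite Dy Dp {1}Db Dj; congr mk; ring.
Qed.

(** * Powers of an ideal of prime norm generated by one element *)

Section Unramified.

Variables (l : nat) (b : int).
Hypotheses (l_pr : prime l) (lq : (l%:Z %| qnorm b)%Z).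

Let lq' : (l%:Z %| qnorm (1 - b))%Z. Proof. by rewrite qnorm_sym. Qed.

(** An element outside the ideal of norm l is comaximal with it; multiplying such relations passes
    to powers of the ideal. *)
Lemma pow_coprime b' y z k : (l%:Z %| qnorm b')%Z -> ~~ (l%:Z %| y - z * b')%Z ->
  exists x w, [/\ powI (lat l b') k x, O w & 1 = x + w * mk y z].
Proof.
move=> lb nd; have iL := ideal_lat lb.
have [x1 [w1 [Lx1 Ow1 E1]]] : exists x w, [/\ lat l b' x, O w & 1 = x + w * mk y z].
  have [u [v uv]] := prime_coprimez l_pr nd.
  exists (mk (u * l%:Z - v * z * b') (- (v * z))), (mk v 0); split.
  - by apply/lat_mk; apply/dvdzP; exists u; ring.
  - exact: O_mk.
  - have -> : 1 = mk 1 0 by rewrite mk_int.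
    by rewrite mkM mkD; congr mk; [rewrite -[LHS]uv; ring | ring].
elim: k => [|k [x [w [Lx Ow E]]]].
  by exists 1, 0; split; [apply: O_1 | apply: O_0 | rewrite mul0r addr0].
have [LO _ _ _] := iL.
exists (x1 * x), (x1 * w + w1 * (x + w * mk y z)); split.
- exact: prodI_mem.
- by apply: O_add; apply: O_mul => //; [apply: LO | rewrite -E; apply: O_1].
- by transitivity ((x1 + w1 * mk y z) * (x + w * mk y z)); [rewrite -E1 -E mulr1 | ring].
Qed.

(** The ideal times its conjugate lies in l O; take k-th powers. *)
Lemma pow_conj k z : prodI (powI (lat l b) k) (powI (lat l (1 - b)) k) z ->
  exists2 w, O w & z = l%:R ^+ k * w.
Proof.
have [iL iL'] := (ideal_lat lq, ideal_lat lq').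
have Ol : O (l%:R) by rewrite pmulrn; apply: O_int.
rewrite -powI_prodI // => h.
suff sub : powI (prodI (lat l b) (lat l (1 - b))) k `<=` scaleI (l%:R ^+ k) O.
  by have [w Ow <-] := sub _ h; exists w.
elim: k {h} => [|k IHk]; first by rewrite expr0 scaleI1.
apply: prodI_min; first by apply: ideal_scaleI (@ideal_O K); apply: O_exp.
move=> x y hx /IHk[w Ow <-].
have [v Ov ->] : exists2 v, O v & x = l%:R * v.
  have : scaleI l%:R O x.
    apply: hx; first by apply: ideal_scaleI (@ideal_O K).
    move=> _ _ [y1 [z1 [-> /dvdzP[t Dt]]]] [y2 [z2 [-> /dvdzP[t' Dt']]]].
    have /dvdzP[n Dn] := lq.
    exists (mk (t * t' * l%:Z + t * z2 * (1 - b) + t' * z1 * b - z1 * z2 * n) (t * z2 + t' * z1)).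
      exact: O_mk.
    have -> : y1 = t * l%:Z + z1 * b by rewrite -Dt subrK.
    have -> : y2 = t' * l%:Z + z2 * (1 - b) by rewrite -Dt' subrK.
    rewrite pmulrn -mk_int !mkM; congr mk; last by ring.
    transitivity (l%:Z * (t * t' * l%:Z + t * z2 * (1 - b) + t' * z1 * b) - z1 * z2 * (n * l%:Z)).
      by ring.
    by rewrite -Dn /qnorm; ring.
  by case=> v Ov <-; exists v.
by exists (v * w); [apply: O_mul | rewrite exprS; ring].
Qed.

Lemma pow_self k : powI (lat l b) k (l%:R ^+ k).
Proof.
elim: k => [|k IHk]; first exact: O_1.
by rewrite exprS; apply: prodI_mem => //; rewrite pmulrn -mk_int; apply: lat_self.
Qed.

(** Let alpha = [mk A B], with conjugate alpha' outside L. Then alpha lies outside the conjugate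
    ideal L', so 1 = x + w alpha with x in L'^n; for z in L^n the product z x is in l^n O, thus a
    multiple of alpha, and so is z. Conversely 1 = x' + w alpha' with x' in L^n, and multiplying by
    alpha puts alpha in L^n. *)
Lemma pow_eq_scale A B n : mk A B * mk (A - B) (- B) = l%:R ^+ n ->
  lat l b (mk A B) -> ~~ (l%:Z %| (A - B) - (- B) * b)%Z ->
  powI (lat l b) n = scaleI (mk A B) O.
Proof.
move=> norm hA hB; have iL := ideal_powI n (ideal_lat lq).
have [LO _ LD LM] := iL.
apply/seteqP; split.
  move=> z Lz.
  have nd : ~~ (l%:Z %| A - B * (1 - b))%Z.
    by apply: contra hB; congr (_ %| _)%Z; ring.
  have [x [w [Lx Ow E]]] := pow_coprime n lq' nd.
  have [v Ov Dv] := pow_conj (prodI_mem Lz Lx).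
  exists (mk (A - B) (- B) * v + w * z).
    by apply: O_add; apply: O_mul => //; [apply: O_mk | apply: LO].
  rewrite mulrDr mulrA norm -Dv.
  by transitivity (z * (x + w * mk A B)); [ring | rewrite -E mulr1].
move=> _ [x Ox <-]; rewrite mulrC; apply: (LM) => //.
have [x' [w [Lx' Ow E]]] := pow_coprime n lq hB.
have -> : mk A B = mk A B * x' + w * l%:R ^+ n.
  rewrite -norm.
  by transitivity (mk A B * (x' + w * mk (A - B) (- B))); [rewrite -E mulr1 | ring].
by apply: LD; apply: LM => //; [apply: O_mk | apply: pow_self].
Qed.

End Unramified.

Hypothesis p_neq3 : p != 3%N.

(** For l != p, exactly one of the element of norm l^|B| and its conjugate lies in the ideal, and
    that one generates the power. *)
Lemma lat_pow_principal (l : nat) b : prime l -> (l%:Z %| qnorm b)%Z ->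
  ideal_equiv (powI (lat l b) `|bernoulli p|) O.
Proof.
move=> l_pr lq; have [lp|lp] := eqVneq l p.
  rewrite lp in lq *; rewrite -[X in ideal_equiv _ X](@powI_O K `|bernoulli p|).
  apply: powI_equiv (lat_ramified lq); [exact: ideal_lat | exact: ideal_O].
have [A [B [nd norm]]] := prime_power_norm_form p_pr p3 p_neq3 l_pr lp lq.
have nB : ~~ (l%:Z %| 2 * b - 1)%Z.
  apply/negP => h; have : (l%:Z %| p%:Z)%Z.
    have -> : p%:Z = 4 * qnorm b - (2 * b - 1) ^+ 2 by rewrite -disc_qnorm addrC addKr.
    by apply: rpredB; [apply: dvdz_mull | rewrite expr2 dvdz_mull].
  by rewrite dvdzE /= dvdn_prime2 // (negbTE lp).
have euclid x y : (l%:Z %| x * y)%Z -> (l%:Z %| x)%Z \/ (l%:Z %| y)%Z.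
  by rewrite !dvdzE abszM Euclid_dvdM //= => /orP.
have n0 : (0 < `|bernoulli p|)%N by have := bernoulli_odd p_pr p3 p_neq3; case: `|bernoulli p|%N.
have normK : mk A B * mk (A - B) (- B) = l%:R ^+ `|bernoulli p|.
  have -> : l%:R ^+ `|bernoulli p| = mk (l ^ `|bernoulli p|)%N 0 by rewrite mk_int -pmulrn natrX.
  by rewrite mkM -norm; congr mk; ring.
have prod_dvd : (l%:Z %| (A - B * b) * ((A - B) - (- B) * b))%Z.
  have -> : (A - B * b) * ((A - B) - (- B) * b)
      = (A ^+ 2 - A * B + c%:Z * B ^+ 2) - B ^+ 2 * qnorm b by rewrite /qnorm; ring.
  apply: rpredB; last exact: dvdz_mull.
  by rewrite norm dvdzE /= dvdn_exp.
(* If both were in the ideal, l would divide B (2 b - 1), hence B and then A, against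
   primitivity. *)
have not_both : (l%:Z %| A - B * b)%Z -> ~~ (l%:Z %| (A - B) - (- B) * b)%Z.
  move=> h1; apply/negP => h2.
  have lB : (l%:Z %| B)%Z.
    have : (l%:Z %| B * (2 * b - 1))%Z.
      have -> : B * (2 * b - 1) = ((A - B) - (- B) * b) - (A - B * b) by ring.
      exact: rpredB.
    by case/euclid => // h; rewrite h in nB.
  move: nd; rewrite lB andbT => /negP; apply.
  by rewrite -(subrK (B * b) A) rpredD // dvdz_mulr.
have a_neq0 : mk A B * mk (A - B) (- B) != 0.
  by rewrite normK expf_neq0 // pmulrn intrK_neq0 // eqz_nat -lt0n prime_gt0.
move: (a_neq0); rewrite mulf_eq0 negb_or => /andP[a1 a2].
have [hA|hA] := boolP (l%:Z %| A - B * b)%Z.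
  rewrite (pow_eq_scale l_pr lq normK) ?not_both //; last by apply/lat_mk.
  by apply: ideal_equiv_scale => //; apply: O_mk.
have hB : (l%:Z %| (A - B) - (- B) * b)%Z.
  by case: (euclid _ _ prod_dvd) => // h; rewrite h in hA.
have DA : (A - B) - - B = A by ring.
have normK' : mk (A - B) (- B) * mk ((A - B) - (- B)) (- (- B)) = l%:R ^+ `|bernoulli p|.
  by rewrite mulrC DA opprK.
rewrite (pow_eq_scale l_pr lq normK').
- by apply: ideal_equiv_scale => //; apply: O_mk.
- by apply/lat_mk.
- by rewrite DA opprK.
Qed.

(** Up to a scalar I is a lattice [lat a b]; prime factors of a are split off one at a time with
    [lat_factor]. *)
Lemma ideal_pow_principal (I : set K) : nonzero_ideal I -> ideal_equiv (powI I `|bernoulli p|) O.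
Proof.
move=> nI; have [d [a [b [d0 a0 dq DI]]]] := ideal_lat_form nI.
have iI : integral_ideal I by case: nI.
have eI : ideal_equiv I (lat a b).
  rewrite DI; apply: ideal_equiv_scale; first by rewrite pmulrn; apply: O_int.
  by rewrite pmulrn; apply: intrK_neq0; rewrite eqz_nat -lt0n.
apply: ideal_equiv_trans (powI_equiv _ iI (ideal_lat dq) eI) _.
move: (a) a0 dq => {nI d a d0 DI iI eI} a; have [n] := ubnP a.
elim: n a => // n IHn a; rewrite ltnS => an a0 dq.
have [a1|a1] := leqP a 1.
  have -> : a = 1%N by apply/eqP; rewrite eqn_leq a1.
  by rewrite lat1 powI_O; apply: ideal_equiv_refl.
have l_pr := pdiv_prime a1; have /dvdnP[a' Da'] := pdiv_dvd a.
move: (pdiv a) l_pr Da' => l l_pr Da'; rewrite mulnC in Da'.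
have a'0 : (0 < a')%N by move: a0; rewrite Da' muln_gt0 => /andP[].
rewrite Da' in dq.
have dql : (l%:Z %| qnorm b)%Z by apply: dvdz_trans dq; rewrite PoszM dvdz_mulr.
have dqa : (a'%:Z %| qnorm b)%Z by apply: dvdz_trans dq; rewrite PoszM dvdz_mull.
have [iL iA] := (ideal_lat dql, ideal_lat dqa).
rewrite Da' lat_factor // powI_prodI //.
have a'n : (a' < n)%N.
  by apply: leq_trans an; rewrite Da' ltn_Pmull // prime_gt1.
apply: ideal_equiv_trans (ideal_equiv_prodI _ _ _ (lat_pow_principal l_pr dql)) _.
- exact: ideal_powI.
- exact: ideal_O.
- exact: ideal_powI.
by rewrite prodI1; [apply: IHn | apply: ideal_powI].
Qed.

Theorem class_number_prime_factor (h : nat) :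
  prime h -> (h %| class_number K)%N -> (h %| `|bernoulli p|)%N.
Proof.
move=> h_pr hK; apply: class_number_prime_dvd finite_classes _ ideal_pow_principal h_pr hK.
by have := bernoulli_odd p_pr p3 p_neq3; case: `|bernoulli p|%N.
Qed.

End QuadraticField.

(** * The sum over the index set *)

Section IndexSum.

Variables (p : nat) (v : int) (delta : nat).
Hypotheses (p_pr : prime p) (p3 : p = 3 %[mod 4]) (p_neq3 : p != 3%N).
Hypothesis v_prim : primitive_root_mod p v.
Hypothesis hdelta : (1 <= delta <= p - 2)%N.

Let g : 'F_p := v%:~R.
Let g_prim : p.-1.-primitive_root g := v_prim.
Let g0 : g != 0. Proof. by rewrite (prim_root_eq0 g_prim) gtn_eqF ?(prim_order_gt0 g_prim). Qed.
Let d : 'F_p := delta%:R.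

Lemma delta_lt : (0 < delta)%N /\ (delta.+1 < p)%N.
Proof. by move: hdelta (prime_gt1 p_pr); clear; lia. Qed.

Lemma Fp_nat_small n : (n < p)%N -> Fp_nat (n%:R : 'F_p) = n.
Proof. by move=> np; rewrite Fp_nat_natr // modn_small. Qed.

Lemma delta_neq0 : d != 0.
Proof.
have [h1 h2] := delta_lt; rewrite /d -(dvdn_pcharf (pchar_Fp p_pr)) gtnNdvd //.
exact: ltnW.
Qed.

Lemma delta_neqN1 : 1 + d != 0.
Proof.
have [h1 h2] := delta_lt; rewrite /d nat1r -(dvdn_pcharf (pchar_Fp p_pr)) gtnNdvd //.
Qed.

(** The default 0 of [ind] is not reached: delta is nonzero modulo p, so it is a power of the
    primitive root. *)
Lemma ind_spec : g ^ (ind p v delta)%:Z = d.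
Proof.
have [_ /ltnW dp] := delta_lt.
have pow_d k : delta = pow_mod p v k -> g ^ k = d.
  by rewrite /d -(Fp_natK (g ^ k)) /pow_mod /Fp_nat => <-.
rewrite /ind; case: pselect => [ex | nex].
  by case: ex_minnP => k /eqP h _; apply: pow_d.
case: nex; have [k Dk] := prim_rootP g_prim (Fp_expr p_pr delta_neq0).
exists k; rewrite /pow_mod -/g -[g ^ _]/(g ^+ k) -Dk.
by rewrite -[val _]/(Fp_nat d) Fp_nat_small.
Qed.

(** Turns the sum over indices into a character sum: the map is a bijection onto the nonzero
    residues, and chi of its value is (-1)^i up to a fixed sign. *)
Definition index_pt (i : 'I_p.-1) : 'F_p := g ^ ((p.-1)./2%:Z - i%:Z).

Lemma mem_I_set i :
  (i \in I_set p v delta) = (p < Fp_nat (index_pt i) + Fp_nat (d * index_pt i)%R)%N.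
Proof.
by rewrite inE /pow_mod -/g (expfzDr (_ - i%:Z) (ind p v delta)%:Z g0) ind_spec mulrC.
Qed.

Lemma index_ptM i : index_pt i * g ^+ i = g ^+ (p.-1)./2.
Proof. by rewrite -[g ^+ i]/(g ^ i%:Z) -expfzDr // subrK. Qed.

(** As chi(g) = -1, the character of g^((p-1)/2 - i) is (-1)^((p-1)/2 - i), and (p - 1) / 2 is
    odd. *)
Lemma chi_index_pt (i : 'I_p.-1) : (-1) ^+ i = - chi (index_pt i).
Proof.
have := congr1 (@chi p) (index_ptM i).
rewrite chiM // !chiX // (chi_prim_root p_pr p3 g_prim) -[in RHS]signr_odd odd_half_pred // expr1.
move=> h; rewrite -[RHS]mulrN1 -[X in _ = _ * X]h mulrA chi_sqr ?mul1r //.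
by rewrite expfz_neq0.
Qed.

Lemma index_pt_inj : injective index_pt.
Proof.
move=> i j e; have := index_ptM i; rewrite -(index_ptM j) e => /mulfI.
rewrite expfz_neq0 // => /(_ isT)/eqP; rewrite (eq_prim_root_expr g_prim).
by rewrite !modn_small // => /eqP/val_inj.
Qed.

Lemma index_pt_surj x : x != 0 -> exists i, x = index_pt i.
Proof.
move=> x0; have : [set index_pt i | i in [set: 'I_p.-1]]%SET = [set~ 0]%SET.
  apply/eqP; rewrite eqEcard; apply/andP; split.
    by apply/fintype.subsetP => _ /imsetP[i _ ->]; rewrite !inE expfz_neq0.
  by rewrite card_imset ?cardsT ?card_ord ?cardsC1 ?card_Fp //; apply: index_pt_inj.
move/setP/(_ x); rewrite !inE x0 => /imsetP[i _ ->]; by exists i.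
Qed.

Lemma index_sum : \sum_(i in I_set p v delta) (-1) ^+ i = - (1 + chi d - chi (1 + d)) * bernoulli p.
Proof.
rewrite mulNr -(chi_carry_sum p_pr p3 p_neq3 delta_neqN1) -sumrN.
have inj : {in I_set p v delta &, injective index_pt} by move=> i j _ _; apply: index_pt_inj.
under eq_bigr => i _ do rewrite chi_index_pt.
rewrite -(big_imset (fun x => - chi x) inj); apply: eq_bigl => x.
apply/imsetP/idP => [[i hi ->] | hx]; first by rewrite -mem_I_set.
have x0 : x != 0.
  by apply: contraTneq hx => ->; rewrite mulr0 -[Fp_nat 0]/0%N addn0 ltn0.
by have [i Dx] := index_pt_surj x0; exists i => //; rewrite mem_I_set -Dx.
Qed.

Lemma index_factor_odd : odd `|(1 + chi d - chi (1 + d))%R|%N.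
Proof.
by case: (chi_cases delta_neq0) => ->; case: (chi_cases delta_neqN1) => ->.
Qed.

End IndexSum.

Theorem theorem4p7 (p : nat) (v : int) (delta : nat)
    (K : fieldExtType rat) (h : nat) :
  prime p -> p = 3 %[mod 4] -> p != 3%N ->
  primitive_root_mod p v ->
  (1 <= delta <= p - 2)%N ->
  is_Q_sqrt K (- p%:Z) ->
  prime h -> odd h -> (h %| class_number K)%N ->
  \sum_(i in I_set p v delta) (-1) ^+ i != 0 :> int /\
  (\sum_(i in I_set p v delta) (-1) ^+ i = 0 %[mod h])%Z.
Proof.
move=> p_pr p3 p_neq3 v_prim hdelta [s s2 gen_s] h_pr _ hK.
rewrite (index_sum p_pr p3 p_neq3 v_prim hdelta) mulNr; split.
  rewrite oppr_eq0 -absz_eq0 abszM; apply/eqP => e.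
  have := index_factor_odd p_pr hdelta; have := bernoulli_odd p_pr p3 p_neq3.
  by move=> o1 o2; have := congr1 odd e; rewrite oddM o1 o2.
have dvd := class_number_prime_factor p_pr p3 s2 gen_s p_neq3 h_pr hK.
by rewrite mod0z; apply/dvdz_mod0P; rewrite rpredN dvdz_mull // dvdzE.
Qed.
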